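(* For any real $d>0$, consider the system $$u''+\frac{d-1}{r}\,u'=(V-1)u,\qquad V''+\frac{d-1}{r}\,V'=u^2$$ subject to the initial conditions $$u(0)=u_0\in\,]0,\infty[,\quad u'(0)=0,\quad V(0)=0,\quad V'(0)=0,$$ where the value $u_0>0$ is not prescribed. Then there is exactly one solution $(u,V)$ of this problem, defined on $[0,\infty[$ (that is, exactly one value $u_0>0$ with its corresponding solution), such that $u(r)>0$ and $u'(r)<0$ for all $r\in\,]0,\infty[$ and $$\lim_{r\to\infty}u(r)=0 .$$ If $d=6$, then $u$ is explicitly given by $$u(r)=\Big(1+\frac{r^2}{24}\Big)^{-2}.$$ In addition, for all $d\ge 6$ this solution satisfies $u(r)=1-V(r)$ for all $r\geq 0$, and the function $u$ solves the Lane-Emden equation $$u''+\frac{d-1}{r}\,u'=-u^2$$ subject to the initial conditions $u(0)=1$, $u'(0)=0$.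
   Context: The parameter $d>0$ is real (not necessarily an integer). A solution on an interval $[0,R[$ ($0<R\le\infty$) is a pair of real-valued functions $(u,V)$ that are $C^2$ on $[0,R[$, satisfy the differential equations on $]0,R[$ and satisfy the initial conditions at $r=0$; equivalently, $u$ and $V$ are continuous on $[0,R[$ with $u(0)=u_0$, $V(0)=0$, and for $r\in\,]0,R[$, $$u'(r)=r^{1-d}\int_0^r (V(s)-1)u(s)s^{d-1}\,ds,\qquad V'(r)=r^{1-d}\int_0^r u(s)^2s^{d-1}\,ds .$$ For each $u_0$ the solution of the initial value problem is unique on its maximal interval of existence. *)

(* Defs.v *)
From Stdlib Require Import Reals.
From Coquelicot Require Import Coquelicot.
Open Scope R_scope.

Definition half_line (r : R) : Prop := 0 <= r.

(* f is of class C^2 on [0,oo[ with derivatives f1 and f2. [D_in] and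
   [continue_in] are relative to the half-line: they are one-sided at 0, and
   the values of f, f1, f2 at negative reals play no role. *)
Definition C2_half_line (f f1 f2 : R -> R) : Prop :=
  forall r : R, 0 <= r ->
    D_in f f1 half_line r /\
    D_in f1 f2 half_line r /\
    continue_in f2 half_line r.

(* (u, V) solves the initial value problem on [0,oo[; u1, u2 are the first two
   derivatives of u, and V1, V2 those of V. C^2 regularity up to r = 0 matters:
   for 0 < d < 1 the function r^(2-d) is annihilated by the radial operator and
   vanishes at 0 together with its first derivative. *)
Definition solution (d u0 : R) (u u1 u2 V V1 V2 : R -> R) : Prop :=
  C2_half_line u u1 u2 /\
  C2_half_line V V1 V2 /\
  (forall r : R, 0 < r -> u2 r + (d - 1) / r * u1 r = (V r - 1) * u r) /\
  (forall r : R, 0 < r -> V2 r + (d - 1) / r * V1 r = u r ^ 2) /\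
  u 0 = u0 /\ u1 0 = 0 /\ V 0 = 0 /\ V1 0 = 0.

Definition decreasing_positive_solution (d u0 : R) (u V : R -> R) : Prop :=
  0 < u0 /\
  exists u1 u2 V1 V2 : R -> R,
    solution d u0 u u1 u2 V V1 V2 /\
    (forall r : R, 0 < r -> 0 < u r /\ u1 r < 0) /\
    is_lim u p_infty 0.

Definition lane_emden_solution (d : R) (u : R -> R) : Prop :=
  exists u1 u2 : R -> R,
    C2_half_line u u1 u2 /\
    (forall r : R, 0 < r -> u2 r + (d - 1) / r * u1 r = - u r ^ 2) /\
    u 0 = 1 /\ u1 0 = 0.

(* Main.v *)
(* In integral form the system reads [u = u0 + G ((V - 1) u)], [V = G (u^2)],
   where [G] inverts the radial Laplacian with regular data at the origin; after
   truncating [u], Picard iteration in an exponentially weighted norm gives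
   global solutions depending continuously on [u0].

   Uniqueness: if [w0 < u0], then [u/w] and [V - W] increase, so that
   [delta = u'/u - w'/w] satisfies [delta' >= delta^2 - (d-1)/r delta + c] with
   [c > 0] and blows up at a finite radius.

   Existence: let [u0] be the supremum of the initial values whose solution
   becomes negative; by continuity its solution is nonincreasing and
   nonnegative, hence positive and strictly decreasing.

   For [d >= 6] Pohozaev's identity shows that the Lane-Emden solution with
   [u(0) = 1] stays positive; with [V = 1 - u] it solves the system, and
   uniqueness identifies it. *)
Require Import Defs.
From Stdlib Require Import Reals Lra Psatz Lia Classical.
From Coquelicot Require Import Coquelicot.
Open Scope R_scope.

(** For [d < 1] the weight s^(d-1) is singular at the origin. The computations therefore run through
    the average A = u'/r, which is continuous up to 0 and satisfies r A' + d A = f; being bounded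
    near 0 singles it out among the solutions of this first-order equation. Functions are continued
    to the left of 0 by constants, so that two-sided continuity on the whole line can be used.

    The quadratic terms are only locally Lipschitz. Truncating [u] to [0, M] at one level, common to
    all initial values, produces a single operator with global solutions; it also switches the force
    off where [u] is negative, so that a solution crossing 0 with negative slope keeps descending.

    The supremum works because two conditions pull in opposite directions: becoming negative is open
    in the initial value, while being nonincreasing, which holds for every solution that becomes
    negative, survives limits. The level M = 8 (d + 2) / d is itself an initial value whose solution
    stays above M/2, so larger initial values remain available whenever the critical solution is
    supposed to become negative. *)

(** * Calculus on the real line: monotonicity, continuity, first hitting points *)

Lemma is_derive_continuity_pt (f : R -> R) (x l : R) :
  is_derive f x l -> continuity_pt f x.
Proof.
intros H. apply continuity_pt_filterlim.
apply (ex_derive_continuous f x). now exists l.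
Qed.

Lemma is_derive_value (f : R -> R) (x l l' : R) :
  is_derive f x l -> l = l' -> is_derive f x l'.
Proof. now intros H <-. Qed.

Lemma mean_value (f df : R -> R) (a b : R) :
  a < b ->
  (forall x, a < x < b -> is_derive f x (df x)) ->
  (forall x, a <= x <= b -> continuity_pt f x) ->
  exists c, a < c < b /\ f b - f a = df c * (b - a).
Proof.
intros ab Hd Hc.
assert (pr1 : forall c, a < c < b -> derivable_pt f c).
{ intros c Hc'. exists (df c). apply is_derive_Reals. now apply Hd. }
destruct (MVT f id a b pr1 (fun c _ => derivable_pt_id c) ab Hc) as [c [P E]].
{ intros c _. apply derivable_continuous_pt, derivable_pt_id. }
exists c. split; [exact P|].
rewrite derive_pt_id in E. unfold id in E.
rewrite (derive_pt_eq_0 f c (df c) (pr1 c P)) in E;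
  [lra | apply is_derive_Reals; now apply Hd].
Qed.

Lemma nonincreasing_of_derive (f df : R -> R) (a b : R) :
  a <= b ->
  (forall x, a < x < b -> is_derive f x (df x)) ->
  (forall x, a <= x <= b -> continuity_pt f x) ->
  (forall x, a < x < b -> df x <= 0) -> f b <= f a.
Proof.
intros [ab| ->] Hd Hc Hs; [|lra].
destruct (mean_value f df a b ab Hd Hc) as [c [P E]].
specialize (Hs c P). nra.
Qed.

Lemma nondecreasing_of_derive (f df : R -> R) (a b : R) :
  a <= b ->
  (forall x, a < x < b -> is_derive f x (df x)) ->
  (forall x, a <= x <= b -> continuity_pt f x) ->
  (forall x, a < x < b -> 0 <= df x) -> f a <= f b.
Proof.
intros [ab| ->] Hd Hc Hs; [|lra].
destruct (mean_value f df a b ab Hd Hc) as [c [P E]].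
specialize (Hs c P). nra.
Qed.

Lemma increasing_of_derive (f df : R -> R) (a b : R) :
  a < b ->
  (forall x, a < x < b -> is_derive f x (df x)) ->
  (forall x, a <= x <= b -> continuity_pt f x) ->
  (forall x, a < x < b -> 0 < df x) -> f a < f b.
Proof.
intros ab Hd Hc Hs.
destruct (mean_value f df a b ab Hd Hc) as [c [P E]].
specialize (Hs c P). nra.
Qed.

Lemma continuity_cst (c : R) : continuity (fun _ => c).
Proof. now apply continuity_const. Qed.

Lemma continuity_pt_near (f : R -> R) (x eps : R) :
  continuity_pt f x -> 0 < eps ->
  exists del, 0 < del /\ forall y, Rabs (y - x) < del -> Rabs (f y - f x) < eps.
Proof.
intros H He. destruct (H eps He) as [del [Hd H']].
exists del. split; [exact Hd|]. intros y Hy.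
destruct (Req_dec y x) as [->|n].
- unfold Rminus. rewrite Rplus_opp_r, Rabs_R0. exact He.
- apply H'. split; [split; [exact I|congruence]|exact Hy].
Qed.

Lemma continuity_pt_intro (f : R -> R) (x : R) :
  (forall eps, 0 < eps ->
   exists del, 0 < del /\ forall y, Rabs (y - x) < del -> Rabs (f y - f x) < eps) ->
  continuity_pt f x.
Proof.
intros H eps He. destruct (H eps He) as [del [Hd H']].
exists del. split; [exact Hd|]. intros y [_ Hy]. now apply H'.
Qed.

(** The point [c] is the supremum of the [t] such that [f > y] on [a, t]. Most positivity arguments
    below stop a function at its first failure through this lemma. *)
Lemma first_hit (f : R -> R) (a b y : R) :
  a <= b -> (forall x, a <= x <= b -> continuity_pt f x) ->
  y < f a -> f b <= y ->
  exists c, a < c <= b /\ f c = y /\ forall x, a <= x < c -> y < f x.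
Proof.
intros ab Hc Ha Hb.
set (E := fun t => a <= t <= b /\ forall x, a <= x <= t -> y < f x).
destruct (completeness E) as [c [Hub Hlub]].
{ exists b. intros t [Ht _]. lra. }
{ exists a. split; [lra|]. intros x Hx. now replace x with a by lra. }
assert (ac : a <= c).
{ apply Hub. split; [lra|]. intros x Hx. now replace x with a by lra. }
assert (cb : c <= b). { apply Hlub. intros t [Ht _]. lra. }
assert (Hlt : forall x, a <= x < c -> y < f x).
{ intros x Hx. apply Rnot_le_lt. intros Hn.
  assert (c <= x); [|lra]. apply Hlub. intros t [Ht Ht'].
  apply Rnot_lt_le. intros Hxt.
  assert (y < f x) by (apply Ht'; lra). lra. }
assert (Hfc : f c = y).
{ destruct (Rtotal_order (f c) y) as [L|[L|L]]; [|exact L|].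
  - exfalso.
    destruct (continuity_pt_near f c (y - f c)) as [del [Hd H']]; [apply Hc; lra|lra|].
    assert (a <> c) by (intros <-; lra).
    set (x := Rmax a (c - del / 2)).
    assert (a <= x < c /\ Rabs (x - c) < del) as [X1 X2].
    { unfold x, Rmax. destruct (Rle_dec a (c - del / 2)); split; try lra;
      rewrite Rabs_left; lra. }
    specialize (H' x X2). specialize (Hlt x X1).
    apply Rabs_def2 in H'. lra.
  - exfalso.
    destruct (continuity_pt_near f c (f c - y)) as [del [Hd H']]; [apply Hc; lra|lra|].
    assert (c <> b) by (intros ->; lra).
    set (x := Rmin b (c + del / 2)).
    assert (X : x <= b /\ c < x /\ x <= c + del / 2).
    { unfold x, Rmin. destruct (Rle_dec b (c + del / 2)); lra. }
    assert (x <= c); [|lra]. apply Hub. split; [lra|].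
    intros z Hz. destruct (Rlt_dec z c) as [zc|zc]; [apply Hlt; lra|].
    assert (Hz' : Rabs (z - c) < del) by (rewrite Rabs_right; lra).
    specialize (H' z Hz'). apply Rabs_def2 in H'. lra. }
exists c. split; [split; [|exact cb]|now split].
destruct ac as [ac| <-]; [exact ac|lra].
Qed.

(** * The radial averaging operator *)

(** [Rpower] is positive even at nonpositive bases; the value 0 there makes [rpow a] continuous on
    the whole line for [a > 0]. *)
Definition rpow (a r : R) : R := if Rle_dec r 0 then 0 else Rpower r a.

Lemma rpow_pos (a r : R) : 0 < r -> 0 < rpow a r.
Proof.
intros H. unfold rpow. destruct (Rle_dec r 0); [lra|]. apply exp_pos.
Qed.

Lemma rpow_0 (a r : R) : r <= 0 -> rpow a r = 0.
Proof. intros H. unfold rpow. now destruct (Rle_dec r 0). Qed.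

Lemma rpow_nonneg (a r : R) : 0 <= rpow a r.
Proof.
destruct (Rle_dec r 0) as [H|H]; [rewrite rpow_0; lra|].
apply Rlt_le, rpow_pos; lra.
Qed.

Lemma is_derive_rpow (a r : R) : 0 < r -> is_derive (rpow a) r (a * rpow a r / r).
Proof.
intros Hr.
apply (is_derive_ext_loc (fun x => exp (a * ln x))).
- exists (mkposreal r Hr). intros y Hy. unfold rpow.
  apply Rabs_def2 in Hy. simpl in Hy. unfold minus, plus, opp in Hy; simpl in Hy.
  destruct (Rle_dec y 0); [lra|reflexivity].
- unfold rpow. destruct (Rle_dec r 0); [lra|]. unfold Rpower.
  auto_derive; [lra|]. field. lra.
Qed.

Lemma rpow_small (a eps : R) :
  0 < a -> 0 < eps -> exists del, 0 < del /\ forall r, r < del -> rpow a r < eps.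
Proof.
intros Ha He. exists (exp (ln eps / a)). split; [apply exp_pos|].
intros r Hr. unfold rpow. destruct (Rle_dec r 0) as [L|L]; [exact He|].
rewrite <- (exp_ln eps He). apply exp_increasing.
apply ln_increasing in Hr; [|lra]. rewrite ln_exp in Hr.
apply Rmult_lt_compat_l with (r := a) in Hr; [|exact Ha].
replace (a * (ln eps / a)) with (ln eps) in Hr by (field; lra). exact Hr.
Qed.

Lemma rpow_large (a K : R) :
  0 < a -> exists r0, 0 < r0 /\ forall r, r0 <= r -> K < rpow a r.
Proof.
intros Ha. exists (exp (Rmax 0 K / a)). split; [apply exp_pos|].
intros r Hr. assert (0 < r) by (apply Rlt_le_trans with (2 := Hr), exp_pos).
unfold rpow. destruct (Rle_dec r 0) as [L|L]; [lra|].
assert (Rmax 0 K / a <= ln r).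
{ rewrite <- (ln_exp (Rmax 0 K / a)). apply ln_le; [apply exp_pos|exact Hr]. }
assert (Rmax 0 K <= a * ln r).
{ apply Rmult_le_compat_l with (r := a) in H0; [|lra].
  replace (a * (Rmax 0 K / a)) with (Rmax 0 K) in H0 by (field; lra). exact H0. }
assert (E := exp_ineq1_le (a * ln r)). unfold Rpower.
assert (K <= Rmax 0 K) by apply Rmax_r. lra.
Qed.

Lemma continuity_rpow (a : R) : 0 < a -> continuity (rpow a).
Proof.
intros Ha r. destruct (Rlt_dec 0 r) as [Hr|Hr].
- apply is_derive_continuity_pt with (1 := is_derive_rpow a r Hr).
- apply continuity_pt_intro. intros eps He.
  destruct (rpow_small a eps Ha He) as [del [Hd H]].
  exists del. split; [exact Hd|]. intros y Hy. apply Rabs_def2 in Hy.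
  rewrite (rpow_0 a r) by lra. rewrite Rminus_0_r, Rabs_right.
  + apply H. lra.
  + apply Rle_ge, rpow_nonneg.
Qed.

Lemma rpow_inv (a r : R) : 0 < a -> 0 <= r -> rpow (/ a) (rpow a r) = r.
Proof.
intros Ha [Hr| <-]; [|now rewrite !rpow_0; try rewrite rpow_0; lra].
assert (H := rpow_pos a r Hr). unfold rpow in *.
destruct (Rle_dec r 0); [lra|]. destruct (Rle_dec (Rpower r a) 0); [lra|].
rewrite Rpower_mult, Rinv_r by lra. now apply Rpower_1.
Qed.

(* [wint d f r] is [d] times the integral of [s^(d-1) f(s)] over [0, r]: the
   substitution [x = s^d] makes the integrand continuous even for [d < 1]. *)
Definition wint (d : R) (f : R -> R) (r : R) : R :=
  RInt (fun x => f (rpow (/ d) x)) 0 (rpow d r).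

Lemma is_derive_RInt_continuity (f : R -> R) (a x : R) :
  continuity f -> is_derive (fun y => RInt f a y) x (f x).
Proof.
intros Hf. assert (Hc : forall z, continuous f z).
{ intros z. apply continuity_pt_filterlim, Hf. }
apply is_derive_RInt with (a := a); [|apply Hc].
apply filter_forall. intros y. apply RInt_correct.
apply (ex_RInt_continuous f). intros z _. apply Hc.
Qed.

Lemma continuity_comp_rpow (a : R) (f : R -> R) :
  0 < a -> continuity f -> continuity (fun x => f (rpow a x)).
Proof.
intros Ha Hf. apply (continuity_comp (rpow a) f); [now apply continuity_rpow|exact Hf].
Qed.

Lemma continuity_wint (d : R) (f : R -> R) :
  0 < d -> continuity f -> continuity (wint d f).
Proof.
intros hd Hf. unfold wint.
assert (Hi := Rinv_0_lt_compat d hd).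
apply (continuity_comp (rpow d) (fun y => RInt (fun x => f (rpow (/ d) x)) 0 y));
  [now apply continuity_rpow|].
intros y. eapply is_derive_continuity_pt.
apply is_derive_RInt_continuity. now apply continuity_comp_rpow.
Qed.

Lemma wint_0 (d : R) (f : R -> R) (r : R) : r <= 0 -> wint d f r = 0.
Proof.
intros Hr. unfold wint. rewrite rpow_0 by exact Hr.
now rewrite RInt_point.
Qed.

(** The chain rule evaluates the integrand at r^d, where [rpow_inv] gives back [f r]; the factor is
    d r^(d-1), written with the power r^d only. *)
Lemma is_derive_wint (d : R) (f : R -> R) (r : R) :
  0 < d -> continuity f -> 0 < r ->
  is_derive (wint d f) r (d * rpow d r / r * f r).
Proof.
intros hd Hf Hr. assert (Hi := Rinv_0_lt_compat d hd).
unfold wint. eapply is_derive_value.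
- apply (is_derive_comp (fun y => RInt (fun x => f (rpow (/ d) x)) 0 y) (rpow d)).
  + apply is_derive_RInt_continuity. now apply continuity_comp_rpow.
  + now apply is_derive_rpow.
- rewrite rpow_inv by lra. reflexivity.
Qed.

Lemma wint_weight_pos (d r : R) : 0 < d -> 0 < r -> 0 < d * rpow d r / r.
Proof.
intros hd Hr. apply Rdiv_lt_0_compat; [|exact Hr].
apply Rmult_lt_0_compat; [exact hd|now apply rpow_pos].
Qed.

Lemma wint_incr_le (d : R) (f g : R -> R) (a b : R) :
  0 < d -> continuity f -> continuity g -> 0 <= a -> a <= b ->
  (forall s, a < s < b -> f s <= g s) ->
  wint d f b - wint d f a <= wint d g b - wint d g a.
Proof.
intros hd Hf Hg Ha ab H.
enough (wint d f b - wint d g b <= wint d f a - wint d g a) by lra.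
apply (nonincreasing_of_derive (fun r => wint d f r - wint d g r)
  (fun r => d * rpow d r / r * f r - d * rpow d r / r * g r)); [exact ab|..].
- intros x Hx. apply (is_derive_minus (wint d f) (wint d g)); apply is_derive_wint; auto; lra.
- intros x _. apply continuity_pt_minus; now apply continuity_wint.
- intros x Hx. assert (P : 0 < d * rpow d x / x) by (apply wint_weight_pos; lra).
  specialize (H x Hx). nra.
Qed.

Lemma wint_incr_lt (d : R) (f g : R -> R) (a b : R) :
  0 < d -> continuity f -> continuity g -> 0 <= a -> a < b ->
  (forall s, a < s < b -> f s < g s) ->
  wint d f b - wint d f a < wint d g b - wint d g a.
Proof.
intros hd Hf Hg Ha ab H.
enough (wint d g a - wint d f a < wint d g b - wint d f b) by lra.
apply (increasing_of_derive (fun r => wint d g r - wint d f r)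
  (fun r => d * rpow d r / r * g r - d * rpow d r / r * f r)); [exact ab|..].
- intros x Hx. apply (is_derive_minus (wint d g) (wint d f)); apply is_derive_wint; auto; lra.
- intros x _. apply continuity_pt_minus; now apply continuity_wint.
- intros x Hx. assert (P : 0 < d * rpow d x / x) by (apply wint_weight_pos; lra).
  specialize (H x Hx). nra.
Qed.

Lemma wint_const (d c a : R) : wint d (fun _ => c) a = c * rpow d a.
Proof.
unfold wint. rewrite RInt_const. unfold scal; simpl; unfold mult; simpl. ring.
Qed.

(* [r * avg d f r] is [r^(1-d)] times the integral of [s^(d-1) f(s)] over
   [0, r], so the solution of [u'' + (d-1)/r u' = f] that is regular at [0]
   has [u' = r * avg d f r]. *)
Definition avg (d : R) (f : R -> R) (r : R) : R :=
  if Rle_dec r 0 then f 0 / d else wint d f r / (d * rpow d r).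

Lemma avg_0 (d : R) (f : R -> R) (r : R) : r <= 0 -> avg d f r = f 0 / d.
Proof. intros H. unfold avg. now destruct (Rle_dec r 0). Qed.

Lemma avg_pos_eq (d : R) (f : R -> R) (r : R) :
  0 < r -> avg d f r = wint d f r / (d * rpow d r).
Proof. intros H. unfold avg. destruct (Rle_dec r 0); [lra|reflexivity]. Qed.

Lemma avg_wint (d : R) (f : R -> R) (r : R) :
  0 < d -> 0 < r -> wint d f r = d * rpow d r * avg d f r.
Proof.
intros hd Hr. rewrite avg_pos_eq by exact Hr.
assert (P := rpow_pos d r Hr). field. lra.
Qed.

Lemma avg_const (d c r : R) : 0 < d -> avg d (fun _ => c) r = c / d.
Proof.
intros hd. unfold avg. destruct (Rle_dec r 0) as [|n]; [reflexivity|].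
rewrite wint_const. assert (P : 0 < rpow d r) by (apply rpow_pos; lra).
field. lra.
Qed.

Lemma avg_le (d : R) (f g : R -> R) (r : R) :
  0 < d -> continuity f -> continuity g ->
  (forall s, 0 <= s <= Rmax 0 r -> f s <= g s) -> avg d f r <= avg d g r.
Proof.
intros hd Hf Hg H. unfold avg. destruct (Rle_dec r 0) as [n|n].
- apply Rmult_le_compat_r; [apply Rlt_le, Rinv_0_lt_compat, hd|].
  apply H. split; [lra|apply Rmax_l].
- assert (P : 0 < rpow d r) by (apply rpow_pos; lra).
  rewrite Rmax_right in H by lra.
  apply Rmult_le_compat_r; [apply Rlt_le, Rinv_0_lt_compat; nra|].
  assert (W := wint_incr_le d f g 0 r hd Hf Hg).
  rewrite !(wint_0 d _ 0) in W by lra.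
  enough (wint d f r - 0 <= wint d g r - 0) by lra. apply W; [lra|lra|].
  intros s Hs. apply H. lra.
Qed.

Lemma avg_lt (d : R) (f g : R -> R) (r : R) :
  0 < d -> continuity f -> continuity g -> 0 < r ->
  (forall s, 0 < s < r -> f s < g s) -> avg d f r < avg d g r.
Proof.
intros hd Hf Hg Hr H. rewrite !avg_pos_eq by exact Hr.
assert (P : 0 < rpow d r) by (apply rpow_pos; lra).
apply Rmult_lt_compat_r; [apply Rinv_0_lt_compat; nra|].
assert (W := wint_incr_lt d f g 0 r hd Hf Hg).
rewrite !(wint_0 d _ 0) in W by lra.
enough (wint d f r - 0 < wint d g r - 0) by lra. apply W; [lra|lra|exact H].
Qed.

Lemma avg_ext (d : R) (f g : R -> R) (r : R) :
  0 < d -> continuity f -> continuity g ->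
  (forall s, 0 <= s <= Rmax 0 r -> f s = g s) -> avg d f r = avg d g r.
Proof.
intros hd Hf Hg H. apply Rle_antisym; apply avg_le; auto; intros s Hs;
rewrite H; auto; lra.
Qed.

Lemma avg_bounds (d : R) (f : R -> R) (r a b : R) :
  0 < d -> continuity f -> (forall s, 0 <= s <= Rmax 0 r -> a <= f s <= b) ->
  a / d <= avg d f r <= b / d.
Proof.
intros hd Hf H. rewrite <- (avg_const d a r hd), <- (avg_const d b r hd).
assert (C : forall c : R, continuity (fun _ => c)).
{ intros c. apply continuity_cst. }
split; apply avg_le; auto; intros s Hs; apply H, Hs.
Qed.

(** This is r A' + d A = f, the radial equation rewritten for A = u'/r, and the form in which
    [avg_unique] recognizes averages. *)
Lemma is_derive_avg (d : R) (f : R -> R) (r : R) :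
  0 < d -> continuity f -> 0 < r ->
  is_derive (avg d f) r ((f r - d * avg d f r) / r).
Proof.
intros hd Hf Hr. assert (P := rpow_pos d r Hr).
apply (is_derive_ext_loc (fun x => wint d f x / (d * rpow d x))).
- exists (mkposreal r Hr). intros y Hy.
  apply Rabs_def2 in Hy. simpl in Hy. unfold minus, plus, opp in Hy; simpl in Hy.
  rewrite avg_pos_eq by lra. reflexivity.
- eapply is_derive_value.
  + apply (is_derive_div (wint d f) (fun x => d * rpow d x)).
    * now apply is_derive_wint.
    * apply (is_derive_scal (rpow d)). now apply is_derive_rpow.
    * nra.
  + rewrite avg_pos_eq by exact Hr.
    field. lra.
Qed.

(** The value [f 0 / d] chosen for [r <= 0] is the limit at the origin: near 0 the function is
    within [eps * d / 2] of [f 0], and averaging preserves such bounds up to the factor 1/d. *)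
Lemma continuity_avg (d : R) (f : R -> R) :
  0 < d -> continuity f -> continuity (avg d f).
Proof.
intros hd Hf r. destruct (Rlt_dec 0 r) as [Hr|Hr].
{ eapply is_derive_continuity_pt. now apply is_derive_avg. }
apply continuity_pt_intro. intros eps He.
destruct (continuity_pt_near f 0 (eps * d / 2)) as [del [Hd H]]; [apply Hf|nra|].
exists del. split; [exact Hd|]. intros y Hy. apply Rabs_def2 in Hy.
rewrite (avg_0 d f r) by lra.
assert (B : (f 0 - eps * d / 2) / d <= avg d f y <= (f 0 + eps * d / 2) / d).
{ apply avg_bounds; auto. intros s Hs.
  assert (Rabs (s - 0) < del).
  { rewrite Rminus_0_r, Rabs_right by lra. apply Rle_lt_trans with (1 := proj2 Hs).
    apply Rmax_lub_lt; lra. }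
  specialize (H s H0). apply Rabs_def2 in H. lra. }
replace ((f 0 - eps * d / 2) / d) with (f 0 / d - eps / 2) in B by (field; lra).
replace ((f 0 + eps * d / 2) / d) with (f 0 / d + eps / 2) in B by (field; lra).
apply Rabs_def1; lra.
Qed.

(* [r^d (B - avg d f)] has derivative [0] and tends to [0] at the origin. *)
Lemma avg_unique (d : R) (f B : R -> R) (del C : R) :
  0 < d -> continuity f -> 0 < del ->
  (forall r, 0 < r < del -> Rabs (B r) <= C) ->
  (forall r, 0 < r -> is_derive B r ((f r - d * B r) / r)) ->
  forall r, 0 < r -> B r = avg d f r.
Proof.
intros hd Hf Hdel HB HB' r Hr.
set (h := fun x => rpow d x * (B x - avg d f x)).
assert (Hh : forall x, 0 < x -> is_derive h x 0).
{ intros x Hx. eapply is_derive_value.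
  - apply (is_derive_mult (rpow d) (fun x => B x - avg d f x)).
    + now apply is_derive_rpow.
    + apply (is_derive_minus B (avg d f)); [now apply HB'|now apply is_derive_avg].
    + intros a b. apply Rmult_comm.
  - unfold plus, mult, minus, plus, opp; simpl. field. lra. }
assert (Hcst : forall x, 0 < x <= r -> h x = h r).
{ intros x Hx. apply Rle_antisym.
  - apply (nondecreasing_of_derive h (fun _ => 0)); [lra|..].
    + intros y Hy. apply Hh. lra.
    + intros y Hy. eapply is_derive_continuity_pt. apply Hh. lra.
    + intros; lra.
  - apply (nonincreasing_of_derive h (fun _ => 0)); [lra|..].
    + intros y Hy. apply Hh. lra.
    + intros y Hy. eapply is_derive_continuity_pt. apply Hh. lra.
    + intros; lra. }
destruct (continuity_pt_near (avg d f) 0 1) as [d1 [Hd1 H1]];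
  [now apply continuity_avg|lra|].
set (K := Rabs C + Rabs (avg d f 0) + 1).
assert (HK : 0 < K).
{ unfold K. assert (Q := Rabs_pos C). assert (Q' := Rabs_pos (avg d f 0)). lra. }
assert (h0 : h r = 0).
{ destruct (Req_dec (h r) 0) as [|Hn]; [assumption|exfalso]. apply Rabs_pos_lt in Hn.
  destruct (rpow_small d (Rabs (h r) / K) hd) as [d2 [Hd2 H2]].
  { now apply Rdiv_lt_0_compat. }
  set (m := Rmin (Rmin del r) (Rmin d1 d2) / 2).
  assert (Hm : 0 < m /\ m < del /\ m < r /\ m < d1 /\ m < d2).
  { assert (Q1 : 0 < Rmin (Rmin del r) (Rmin d1 d2)) by (repeat apply Rmin_pos; lra).
    assert (Q2 := Rmin_l (Rmin del r) (Rmin d1 d2)).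
    assert (Q3 := Rmin_r (Rmin del r) (Rmin d1 d2)).
    assert (Q4 := Rmin_l del r). assert (Q5 := Rmin_r del r).
    assert (Q6 := Rmin_l d1 d2). assert (Q7 := Rmin_r d1 d2).
    unfold m. lra. }
  rewrite <- (Hcst m) in Hn, H2 by lra.
  assert (E : Rabs (h m) <= rpow d m * K).
  { unfold h. rewrite Rabs_mult, (Rabs_right (rpow d m)) by apply Rle_ge, rpow_nonneg.
    apply Rmult_le_compat_l; [apply rpow_nonneg|].
    assert (Q1 : Rabs (B m) <= C) by (apply HB; lra).
    assert (Q2 : Rabs (m - 0) < d1) by (rewrite Rminus_0_r, Rabs_right; lra).
    specialize (H1 m Q2).
    assert (Q3 := Rabs_triang (B m) (- avg d f m)). rewrite Rabs_Ropp in Q3.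
    assert (Q4 := Rabs_triang_inv (avg d f m) (avg d f 0)).
    assert (Q5 := Rle_abs C). unfold K. unfold Rminus in *. lra. }
  assert (rpow d m < Rabs (h m) / K) by (apply H2; lra).
  assert (rpow d m * K < Rabs (h m) / K * K) by (apply Rmult_lt_compat_r; lra).
  replace (Rabs (h m) / K * K) with (Rabs (h m)) in H0 by (field; lra). lra. }
unfold h in h0. assert (P := rpow_pos d r Hr).
apply Rmult_integral in h0. destruct h0; lra.
Qed.

Lemma is_derive_r_avg (d : R) (f : R -> R) (r : R) :
  0 < d -> continuity f -> 0 < r ->
  is_derive (fun x => x * avg d f x) r (f r - (d - 1) / r * (r * avg d f r)).
Proof.
intros hd Hf Hr. eapply is_derive_value.
- apply (is_derive_mult (fun x => x) (avg d f)).
  + apply is_derive_id.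
  + now apply is_derive_avg.
  + intros a b. apply Rmult_comm.
- unfold plus, mult, one; simpl. field. lra.
Qed.

(** * The solution operator of the radial Poisson equation *)

(** The operator [G] of the overview. The factor [Rmax 0 t] makes it vanish for [r <= 0], so that
    its values are differentiable on the whole line. *)
Definition rsol (d : R) (f : R -> R) (r : R) : R :=
  RInt (fun t => Rmax 0 t * avg d f t) 0 r.

Lemma continuity_Rmax0 : continuity (Rmax 0).
Proof.
intros x. apply continuity_pt_intro. intros eps He. exists eps. split; [exact He|].
intros y Hy. apply Rle_lt_trans with (2 := Hy).
unfold Rmax. destruct (Rle_dec 0 y), (Rle_dec 0 x);
unfold Rabs; repeat destruct Rcase_abs; lra.
Qed.

Lemma is_derive_rsol (d : R) (f : R -> R) (r : R) :
  0 < d -> continuity f -> is_derive (rsol d f) r (Rmax 0 r * avg d f r).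
Proof.
intros hd Hf. unfold rsol.
apply (is_derive_RInt_continuity (fun t => Rmax 0 t * avg d f t)).
apply continuity_mult; [apply continuity_Rmax0|now apply continuity_avg].
Qed.

Lemma is_derive_rsol_pos (d : R) (f : R -> R) (r : R) :
  0 < d -> continuity f -> 0 <= r -> is_derive (rsol d f) r (r * avg d f r).
Proof.
intros hd Hf Hr. rewrite <- (Rmax_right 0 r) at 2 by exact Hr.
now apply is_derive_rsol.
Qed.

Lemma continuity_rsol (d : R) (f : R -> R) :
  0 < d -> continuity f -> continuity (rsol d f).
Proof.
intros hd Hf r. eapply is_derive_continuity_pt. now apply is_derive_rsol.
Qed.

Lemma rsol_0 (d : R) (f : R -> R) (r : R) : r <= 0 -> rsol d f r = 0.
Proof.
intros Hr. unfold rsol. rewrite (RInt_ext _ (fun _ => 0)).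
- rewrite RInt_const. apply Rmult_0_r.
- intros x Hx. rewrite Rmax_left in Hx by exact Hr.
  rewrite Rmax_left by lra. apply Rmult_0_l.
Qed.

Lemma rsol_eq_of_derive (d : R) (f g : R -> R) :
  0 < d -> continuity f -> continuity g ->
  (forall r, 0 < r -> is_derive g r (r * avg d f r)) ->
  forall r, 0 <= r -> g r = g 0 + rsol d f r.
Proof.
intros hd Hf Hg H r Hr.
assert (D : forall x, 0 < x < r -> is_derive (fun x => g x - rsol d f x) x 0).
{ intros x Hx. eapply is_derive_value.
  - apply (is_derive_minus g (rsol d f)); [apply H; lra|apply is_derive_rsol_pos; auto; lra].
  - unfold minus, plus, opp; simpl. ring. }
assert (C : forall x, 0 <= x <= r -> continuity_pt (fun x => g x - rsol d f x) x).
{ intros x _. apply continuity_pt_minus; [apply Hg|now apply continuity_rsol]. }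
assert (L1 := nonincreasing_of_derive _ (fun _ => 0) 0 r Hr D C (fun _ _ => Rle_refl 0)).
assert (L2 := nondecreasing_of_derive _ (fun _ => 0) 0 r Hr D C (fun _ _ => Rle_refl 0)).
simpl in L1, L2. rewrite (rsol_0 d f 0) in L1, L2 by lra. lra.
Qed.

Lemma rsol_incr_le (d : R) (f g : R -> R) (a b : R) :
  0 < d -> continuity f -> continuity g -> 0 <= a -> a <= b ->
  (forall s, 0 <= s <= b -> f s <= g s) ->
  rsol d f b - rsol d f a <= rsol d g b - rsol d g a.
Proof.
intros hd Hf Hg Ha ab H.
enough (rsol d f b - rsol d g b <= rsol d f a - rsol d g a) by lra.
apply (nonincreasing_of_derive (fun r => rsol d f r - rsol d g r)
  (fun r => r * avg d f r - r * avg d g r)); [exact ab|..].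
- intros x Hx.
  apply (is_derive_minus (rsol d f) (rsol d g)); apply is_derive_rsol_pos; auto; lra.
- intros x _. apply continuity_pt_minus; now apply continuity_rsol.
- intros x Hx. assert (avg d f x <= avg d g x).
  { apply avg_le; auto. intros s Hs. rewrite Rmax_right in Hs by lra. apply H. lra. }
  nra.
Qed.

Lemma rsol_le (d : R) (f g : R -> R) (r : R) :
  0 < d -> continuity f -> continuity g -> 0 <= r ->
  (forall s, 0 <= s <= r -> f s <= g s) -> rsol d f r <= rsol d g r.
Proof.
intros hd Hf Hg Hr H.
assert (L := rsol_incr_le d f g 0 r hd Hf Hg (Rle_refl 0) Hr H).
rewrite !(rsol_0 d _ 0) in L by lra. lra.
Qed.

Lemma rsol_ext (d : R) (f g : R -> R) (r : R) :
  0 < d -> continuity f -> continuity g ->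
  (forall s, 0 <= s -> f s = g s) -> rsol d f r = rsol d g r.
Proof.
intros hd Hf Hg H. destruct (Rle_dec r 0) as [Hr|Hr].
- now rewrite !rsol_0 by exact Hr.
- apply Rle_antisym; apply rsol_le; auto; try lra; intros s Hs; rewrite H; lra.
Qed.

Lemma rsol_const (d c r : R) :
  0 < d -> 0 <= r -> rsol d (fun _ => c) r = c * r ^ 2 / (2 * d).
Proof.
intros hd Hr.
assert (C : forall c : R, continuity (fun _ => c)) by (intros a; apply continuity_cst).
assert (D : forall x, is_derive (fun x => c * x ^ 2 / (2 * d)) x (x * avg d (fun _ => c) x)).
{ intros x. rewrite avg_const by exact hd. auto_derive; [exact I|]. field. lra. }
rewrite (rsol_eq_of_derive d (fun _ => c) (fun x => c * x ^ 2 / (2 * d)) hd (C c)); auto.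
- field. lra.
- intros x. eapply is_derive_continuity_pt, D.
Qed.

(** * Comparison of solutions in exponentially weighted norms *)

Lemma exp_nondecreasing (x y : R) : x <= y -> exp x <= exp y.
Proof. intros [H| ->]; [now apply Rlt_le, exp_increasing|lra]. Qed.

Lemma wint_plus_const (d c : R) (f : R -> R) (r : R) :
  0 < d -> continuity f ->
  wint d (fun x => f x + c) r = wint d f r + c * rpow d r.
Proof.
intros hd Hf. rewrite <- wint_const. unfold wint.
apply (RInt_plus (fun x => f (rpow (/ d) x)) (fun _ => c)).
- apply (ex_RInt_continuous (fun x => f (rpow (/ d) x))). intros z _.
  apply continuity_pt_filterlim, continuity_comp_rpow; [|exact Hf].
  now apply Rinv_0_lt_compat.
- apply ex_RInt_const.
Qed.

Lemma avg_plus_const (d c : R) (f : R -> R) (r : R) :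
  0 < d -> continuity f -> avg d (fun x => f x + c) r = avg d f r + c / d.
Proof.
intros hd Hf. unfold avg. destruct (Rle_dec r 0) as [n|n]; [field; lra|].
rewrite wint_plus_const by assumption.
assert (P : 0 < rpow d r) by (apply rpow_pos; lra). field. lra.
Qed.

Lemma avg_le_plus (d c : R) (f g : R -> R) (r : R) :
  0 < d -> continuity f -> continuity g ->
  (forall s, 0 <= s <= Rmax 0 r -> f s <= g s + c) -> avg d f r <= avg d g r + c / d.
Proof.
intros hd Hf Hg H. rewrite <- avg_plus_const by assumption.
apply avg_le; auto. apply continuity_plus; [exact Hg|apply continuity_cst].
Qed.

Lemma continuity_exp_lin (L : R) : continuity (fun x => exp (L * x)).
Proof.
intros x. eapply is_derive_continuity_pt. auto_derive; [exact I|reflexivity].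
Qed.

(** Since the weight increases, averaging the error up to [x] costs at most [M * exp (L * x) / d];
    multiplying by [x <= b] and integrating the exponential gains the factor 1/L. *)
Lemma rsol_exp_le (d : R) (f g : R -> R) (b L M r : R) :
  0 < d -> continuity f -> continuity g -> 0 < L -> 0 <= M ->
  (forall s, 0 <= s <= b -> f s <= g s + M * exp (L * s)) ->
  0 <= r <= b -> rsol d f r <= rsol d g r + M * b / (d * L) * exp (L * r).
Proof.
intros hd Hf Hg HL HM H Hr.
assert (P : 0 <= M * b / (d * L)).
{ apply Rmult_le_pos; [nra|]. apply Rlt_le, Rinv_0_lt_compat. nra. }
set (C := M * b / (d * L)) in *.
assert (E : rsol d f r - rsol d g r - C * exp (L * r)
         <= rsol d f 0 - rsol d g 0 - C * exp (L * 0)).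
{ apply (nonincreasing_of_derive (fun x => rsol d f x - rsol d g x - C * exp (L * x))
    (fun x => x * avg d f x - x * avg d g x - C * (L * exp (L * x)))); [lra|..].
  - intros x Hx.
    apply (is_derive_minus (fun x => rsol d f x - rsol d g x) (fun x => C * exp (L * x))).
    + apply (is_derive_minus (rsol d f) (rsol d g)); apply is_derive_rsol_pos; auto; lra.
    + auto_derive; [exact I|]. ring.
  - intros x _. apply continuity_pt_minus.
    + apply continuity_pt_minus; now apply continuity_rsol.
    + apply continuity_pt_mult; [apply continuity_cst|apply continuity_exp_lin].
  - intros x Hx.
    assert (A : avg d f x <= avg d g x + M * exp (L * x) / d).
    { apply avg_le_plus; auto. intros s Hs. rewrite Rmax_right in Hs by lra.
      apply Rle_trans with (1 := H s ltac:(lra)).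
      apply Rplus_le_compat_l, Rmult_le_compat_l; [exact HM|].
      apply exp_nondecreasing. nra. }
    replace (C * (L * exp (L * x))) with (b * (M * exp (L * x) / d)) by (unfold C; field; lra).
    assert (0 <= M * exp (L * x) / d).
    { apply Rmult_le_pos; [|apply Rlt_le, Rinv_0_lt_compat, hd].
      apply Rmult_le_pos; [exact HM|apply Rlt_le, exp_pos]. }
    nra. }
rewrite !(rsol_0 d _ 0) in E by lra. rewrite Rmult_0_r, exp_0 in E. lra.
Qed.

Lemma rsol_exp_dist (d : R) (f g : R -> R) (b L M r : R) :
  0 < d -> continuity f -> continuity g -> 0 < L -> 0 <= M ->
  (forall s, 0 <= s <= b -> Rabs (f s - g s) <= M * exp (L * s)) ->
  0 <= r <= b -> Rabs (rsol d f r - rsol d g r) <= M * b / (d * L) * exp (L * r).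
Proof.
intros hd Hf Hg HL HM H Hr.
assert (L1 : rsol d f r <= rsol d g r + M * b / (d * L) * exp (L * r)).
{ apply rsol_exp_le; auto. intros s Hs. specialize (H s Hs).
  apply Rabs_le_between in H. lra. }
assert (L2 : rsol d g r <= rsol d f r + M * b / (d * L) * exp (L * r)).
{ apply rsol_exp_le; auto. intros s Hs. specialize (H s Hs).
  apply Rabs_le_between in H. lra. }
apply Rabs_le. lra.
Qed.

(** * Radial equations with a causal Lipschitz right-hand side *)

(** The constant [K] is chosen before the weight [L], so that [L] can later be taken large compared
    with [K]. The bound at [s] is in terms of a weight increasing up to [s], which suits operators
    like the force, where [N u s] involves an integral of [u] over [0, s]. *)
Definition causal_lipschitz (N : (R -> R) -> R -> R) : Prop :=
  (forall u, continuity u -> continuity (N u)) /\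
  forall b, 0 < b -> exists K, 0 < K /\
    forall u w L M, continuity u -> continuity w -> 0 <= L -> 0 <= M ->
    (forall s, 0 <= s <= b -> Rabs (u s - w s) <= M * exp (L * s)) ->
    forall s, 0 <= s <= b -> Rabs (N u s - N w s) <= K * M * exp (L * s).

(** The identity is imposed for negative [r] too, where it forces [u r = a]; equality of two fixed
    points can then be stated on the whole line. *)
Definition radial_fixpoint (d : R) (N : (R -> R) -> R -> R) (a : R) (u : R -> R) : Prop :=
  continuity u /\ forall r, u r = a + rsol d (N u) r.

(* In the norm weighted by [exp (- L r)] the integral operator is a
   contraction by 1/2 on [0, b]. *)
Lemma causal_contraction (d : R) (N : (R -> R) -> R -> R) (b : R) :
  0 < d -> causal_lipschitz N -> 0 < b ->
  exists L, 0 < L /\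
    forall u w M, continuity u -> continuity w -> 0 <= M ->
    (forall s, 0 <= s <= b -> Rabs (u s - w s) <= M * exp (L * s)) ->
    forall s, 0 <= s <= b ->
      Rabs (rsol d (N u) s - rsol d (N w) s) <= M / 2 * exp (L * s).
Proof.
intros hd [Hc Hl] Hb. destruct (Hl b Hb) as [K [HK H]].
(* With this weight the factor K b / (d L) of [rsol_exp_dist] is exactly 1/2. *)
exists (2 * K * b / d).
assert (HL : 0 < 2 * K * b / d) by (apply Rdiv_lt_0_compat; nra).
split; [exact HL|]. intros u w M Hu Hw HM Huw s Hs.
replace (M / 2) with (K * M * b / (d * (2 * K * b / d))) by (field; lra).
apply rsol_exp_dist; auto; [nra|].
intros t Ht. apply H; auto. lra.
Qed.

(** The weighted maximum q of |u - u'| satisfies q <= |a - a'| + q/2 by the contraction, hence q <=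
    2 |a - a'|; removing the weight on [0, b] costs exp(L b). The constant is uniform in both
    initial values, as shooting requires. *)
Lemma radial_fixpoint_dependence (d : R) (N : (R -> R) -> R -> R) (b : R) :
  0 < d -> causal_lipschitz N -> 0 < b ->
  exists C, 0 < C /\
    forall a a' u u', radial_fixpoint d N a u -> radial_fixpoint d N a' u' ->
    forall r, 0 <= r <= b -> Rabs (u r - u' r) <= C * Rabs (a - a').
Proof.
intros hd HN Hb. destruct (causal_contraction d N b hd HN Hb) as [L [HL H]].
exists (2 * exp (L * b)). split; [assert (Q := exp_pos (L * b)); lra|].
intros a a' u u' [Hu Eu] [Hu' Eu'] r Hr.
set (q := fun x => Rabs (u x - u' x) * exp (- L * x)).
assert (Hq : continuity q).
{ unfold q. apply continuity_mult; [|apply continuity_exp_lin].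
  apply (continuity_comp (fun x => u x - u' x) Rabs); [|exact Rcontinuity_abs].
  now apply continuity_minus. }
destruct (continuity_ab_maj q 0 b) as [m [Hm1 Hm2]]; [lra|intros c _; apply Hq|].
assert (Hexp : forall x, exp (- L * x) * exp (L * x) = 1).
{ intros x. rewrite <- exp_plus. replace (- L * x + L * x) with 0 by ring. apply exp_0. }
assert (Hmul : forall x, Rabs (u x - u' x) = q x * exp (L * x)).
{ intros x. unfold q. rewrite Rmult_assoc, Hexp. ring. }
assert (Hqm : 0 <= q m).
{ unfold q. apply Rmult_le_pos; [apply Rabs_pos|apply Rlt_le, exp_pos]. }
assert (Hle : forall s, 0 <= s <= b -> Rabs (u s - u' s) <= q m * exp (L * s)).
{ intros s Hs. rewrite Hmul. apply Rmult_le_compat_r; [apply Rlt_le, exp_pos|].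
  now apply Hm1. }
assert (B := H u u' (q m) Hu Hu' Hqm Hle m Hm2).
assert (Hqa : q m <= 2 * Rabs (a - a')).
{ assert (T : Rabs (u m - u' m) <= Rabs (a - a') + q m / 2 * exp (L * m)).
  { rewrite Eu, Eu'.
    replace (a + rsol d (N u) m - (a' + rsol d (N u') m))
      with ((a - a') + (rsol d (N u) m - rsol d (N u') m)) by ring.
    apply Rle_trans with (1 := Rabs_triang _ _). lra. }
  rewrite Hmul in T.
  assert (E1 : 1 <= exp (L * m)).
  { rewrite <- exp_0. apply exp_nondecreasing. nra. }
  nra. }
apply Rle_trans with (1 := Hle r Hr).
assert (E2 : exp (L * r) <= exp (L * b)) by (apply exp_nondecreasing; nra).
assert (0 < exp (L * r)) by apply exp_pos. nra.
Qed.

Lemma radial_fixpoint_unique (d : R) (N : (R -> R) -> R -> R) (a : R) (u w : R -> R) :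
  0 < d -> causal_lipschitz N ->
  radial_fixpoint d N a u -> radial_fixpoint d N a w -> forall r, u r = w r.
Proof.
intros hd HN Hu Hw r. destruct (Rle_dec r 0) as [Hr|Hr].
{ rewrite (proj2 Hu), (proj2 Hw). now rewrite !rsol_0. }
destruct (radial_fixpoint_dependence d N r hd HN) as [C [HC H]]; [lra|].
specialize (H a a u w Hu Hw r). rewrite Rminus_diag, Rabs_R0, Rmult_0_r in H.
assert (Q := Rabs_pos (u r - w r)).
apply Rminus_diag_uniq. destruct (Req_dec (u r - w r) 0) as [|n]; [assumption|].
apply Rabs_pos_lt in n. lra.
Qed.

Fixpoint picard (d : R) (N : (R -> R) -> R -> R) (a : R) (n : nat) : R -> R :=
  match n with
  | O => fun _ => a
  | S n => fun r => a + rsol d (N (picard d N a n)) r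
  end.

Lemma continuity_picard (d : R) (N : (R -> R) -> R -> R) (a : R) (n : nat) :
  0 < d -> causal_lipschitz N -> continuity (picard d N a n).
Proof.
intros hd [Hc _]. induction n as [|n IH]; simpl.
- apply continuity_cst.
- apply continuity_plus; [apply continuity_cst|].
  apply continuity_rsol; auto.
Qed.

(** The contraction is returned along with the estimate because both must refer to the same weight
    [L] when the limit is shown to be a fixed point. *)
Lemma picard_cauchy (d : R) (N : (R -> R) -> R -> R) (a b : R) :
  0 < d -> causal_lipschitz N -> 0 < b ->
  exists D L, 0 <= D /\ 0 < L /\
  (forall u w M, continuity u -> continuity w -> 0 <= M ->
    (forall s, 0 <= s <= b -> Rabs (u s - w s) <= M * exp (L * s)) ->
    forall s, 0 <= s <= b ->
      Rabs (rsol d (N u) s - rsol d (N w) s) <= M / 2 * exp (L * s)) /\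
  forall n k r, r <= b ->
    Rabs (picard d N a (n + k) r - picard d N a n r) <= D * (/ 2) ^ n * exp (L * r).
Proof.
intros hd HN Hb. destruct (causal_contraction d N b hd HN Hb) as [L [HL H]].
assert (Hp := fun n => continuity_picard d N a n hd HN).
set (p := picard d N a) in *.
assert (Hq : continuity (fun x => Rabs (p 1%nat x - p 0%nat x))).
{ apply (continuity_comp (fun x => p 1%nat x - p 0%nat x) Rabs); [|exact Rcontinuity_abs].
  apply continuity_minus; apply Hp. }
destruct (continuity_ab_maj _ 0 b (Rlt_le _ _ Hb) (fun c _ => Hq c)) as [m [Hm _]].
set (D := Rabs (p 1%nat m - p 0%nat m)) in *. assert (HD : 0 <= D) by apply Rabs_pos.
assert (Hhalf : forall n, 0 < (/ 2) ^ n) by (intros n; apply pow_lt; lra).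
exists (2 * D), L. split; [lra|]. split; [exact HL|]. split; [exact H|].
assert (step : forall n r, 0 <= r <= b ->
  Rabs (p (S n) r - p n r) <= D * (/ 2) ^ n * exp (L * r)).
{ induction n as [|n IH]; intros r Hr.
  - specialize (Hm r Hr). assert (1 <= exp (L * r)).
    { rewrite <- exp_0. apply exp_nondecreasing. nra. }
    simpl pow. fold D in Hm. nra.
  - assert (Q := H (p (S n)) (p n) (D * (/ 2) ^ n) (Hp _) (Hp _)).
    replace (p (S (S n)) r - p (S n) r)
      with (rsol d (N (p (S n))) r - rsol d (N (p n)) r) by (unfold p; simpl; ring).
    replace (D * (/ 2) ^ S n) with (D * (/ 2) ^ n / 2) by (simpl; field).
    apply Q; auto. specialize (Hhalf n). nra. }
intros n k r Hr.
destruct (Rlt_dec r 0) as [Hr0|Hr0].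
{ assert (E : forall j, p j r = a).
  { intros [|j]; unfold p; simpl; [reflexivity|]. rewrite rsol_0 by lra. ring. }
  rewrite !E, Rminus_diag, Rabs_R0.
  apply Rmult_le_pos; [specialize (Hhalf n); nra|apply Rlt_le, exp_pos]. }
(* The geometric series of the consecutive differences, in closed form so that the induction on [k]
   telescopes. *)
assert (sum : Rabs (p (n + k)%nat r - p n r)
  <= D * exp (L * r) * (2 * (/ 2) ^ n - 2 * (/ 2) ^ (n + k))).
{ induction k as [|k IH].
  - rewrite Nat.add_0_r, Rminus_diag, Rabs_R0. lra.
  - rewrite Nat.add_succ_r.
    replace (p (S (n + k)) r - p n r)
      with ((p (S (n + k)) r - p (n + k)%nat r) + (p (n + k)%nat r - p n r)) by ring.
    apply Rle_trans with (1 := Rabs_triang _ _).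
    assert (S1 := step (n + k)%nat r ltac:(lra)). simpl pow. lra. }
apply Rle_trans with (1 := sum).
assert (0 <= D * exp (L * r)) by (apply Rmult_le_pos; [exact HD|apply Rlt_le, exp_pos]).
specialize (Hhalf (n + k)%nat). nra.
Qed.

Lemma half_pow_small (C eps : R) : 0 < eps -> exists n, C * (/ 2) ^ n < eps.
Proof.
intros He. assert (L : is_lim_seq (fun n => C * (/ 2) ^ n) (C * 0)).
{ apply (is_lim_seq_scal_l (fun n => (/ 2) ^ n) C 0).
  apply is_lim_seq_geom. rewrite Rabs_right; lra. }
rewrite Rmult_0_r in L. apply is_lim_seq_spec in L.
destruct (L (mkposreal eps He)) as [n Hn]. exists n.
specialize (Hn n (Nat.le_refl n)). simpl in Hn. apply Rabs_def2 in Hn. lra.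
Qed.

Lemma radial_fixpoint_exists (d : R) (N : (R -> R) -> R -> R) (a : R) :
  0 < d -> causal_lipschitz N -> exists u, radial_fixpoint d N a u.
Proof.
intros hd HN.
assert (Hp := fun n => continuity_picard d N a n hd HN).
set (u := fun r => real (Lim_seq (fun n => picard d N a n r))).
assert (Hu : forall r, is_lim_seq (fun n => picard d N a n r) (u r)).
{ intros r. apply Lim_seq_correct'. apply ex_lim_seq_cauchy_corr. intros eps.
  destruct (picard_cauchy d N a (Rabs r + 1) hd HN) as [D [L [HD [HL [_ H]]]]].
  { assert (Q := Rabs_pos r). lra. }
  destruct (half_pow_small (D * exp (L * r)) (eps / 2)) as [n0 Hn0].
  { assert (Q := cond_pos eps). lra. }
  exists n0. intros n m Hn Hm.
  assert (Hr : r <= Rabs r + 1) by (assert (Q := Rle_abs r); lra).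
  assert (H1 := H n0 (n - n0)%nat r Hr). assert (H2 := H n0 (m - n0)%nat r Hr).
  replace (n0 + (n - n0))%nat with n in H1 by lia.
  replace (n0 + (m - n0))%nat with m in H2 by lia.
  apply Rabs_le_between in H1. apply Rabs_le_between in H2.
  apply Rabs_def1; lra. }
assert (Hbd : forall b, 0 < b -> exists D L, 0 <= D /\ 0 < L /\
  (forall u w M, continuity u -> continuity w -> 0 <= M ->
    (forall s, 0 <= s <= b -> Rabs (u s - w s) <= M * exp (L * s)) ->
    forall s, 0 <= s <= b ->
      Rabs (rsol d (N u) s - rsol d (N w) s) <= M / 2 * exp (L * s)) /\
  forall n r, r <= b ->
    Rabs (u r - picard d N a n r) <= D * (/ 2) ^ n * exp (L * r)).
{ intros b Hb. destruct (picard_cauchy d N a b hd HN Hb) as [D [L [HD [HL [Hctr H]]]]].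
  exists D, L. split; [exact HD|split; [exact HL|split; [exact Hctr|]]].
  intros n r Hr.
  assert (Hlim : is_lim_seq (fun k => Rabs (picard d N a (k + n) r - picard d N a n r))
                  (Rabs (u r - picard d N a n r))).
  { apply (is_lim_seq_abs _ (Finite _)).
    apply is_lim_seq_minus'; [|apply is_lim_seq_const].
    now apply (is_lim_seq_incr_n (fun k => picard d N a k r) n). }
  assert (Hle : forall k, Rabs (picard d N a (k + n) r - picard d N a n r)
                  <= D * (/ 2) ^ n * exp (L * r)).
  { intros k. rewrite Nat.add_comm. now apply H. }
  exact (is_lim_seq_le _ _ (Finite _) (Finite _) Hle Hlim (is_lim_seq_const _)). }
assert (Huc : continuity u).
{ intros x. assert (Hb : 0 < Rabs x + 1) by (assert (Q := Rabs_pos x); lra).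
  destruct (Hbd _ Hb) as [D [L [HD [HL [_ H]]]]].
  apply (CVU_continuity (picard d N a) u 0 (mkposreal _ Hb)).
  - intros eps He.
    destruct (half_pow_small (D * exp (L * (Rabs x + 1))) eps He) as [n0 Hn0].
    exists n0. intros n y Hn Hy. unfold Boule in Hy. simpl in Hy.
    rewrite Rminus_0_r in Hy. apply Rabs_def2 in Hy.
    apply Rle_lt_trans with (1 := H n y ltac:(lra)).
    apply Rle_lt_trans with (2 := Hn0).
    assert ((/ 2) ^ n <= (/ 2) ^ n0).
    { replace n with (n0 + (n - n0))%nat by lia. rewrite pow_add.
      assert (0 < (/ 2) ^ n0) by (apply pow_lt; lra).
      assert ((/ 2) ^ (n - n0) <= 1).
      { rewrite <- (pow1 (n - n0)). apply pow_incr. lra. }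
      nra. }
    assert (exp (L * y) <= exp (L * (Rabs x + 1))) by (apply exp_nondecreasing; nra).
    assert (0 < exp (L * y)) by apply exp_pos.
    assert (0 < (/ 2) ^ n) by (apply pow_lt; lra).
    replace (D * (/ 2) ^ n * exp (L * y)) with (D * ((/ 2) ^ n * exp (L * y))) by ring.
    replace (D * exp (L * (Rabs x + 1)) * (/ 2) ^ n0)
      with (D * ((/ 2) ^ n0 * exp (L * (Rabs x + 1)))) by ring.
    apply Rmult_le_compat_l; [exact HD|]. apply Rmult_le_compat; lra.
  - intros n y _. apply Hp.
  - unfold Boule. simpl. rewrite Rminus_0_r. lra. }
exists u. split; [exact Huc|]. intros r.
destruct (Rle_dec r 0) as [Hr|Hr].
{ rewrite rsol_0, Rplus_0_r by exact Hr. unfold u.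
  rewrite (Lim_seq_ext _ (fun _ => a)); [now rewrite Lim_seq_const|].
  intros [|n]; simpl; [reflexivity|]. rewrite rsol_0 by exact Hr. ring. }
destruct (Hbd r) as [D [L [HD [HL [Hctr H]]]]]; [lra|].
apply Rminus_diag_uniq.
destruct (Req_dec (u r - (a + rsol d (N u) r)) 0) as [|n]; [assumption|exfalso].
apply Rabs_pos_lt in n.
destruct (half_pow_small (D * exp (L * r)) _ n) as [k Hk].
(* The defect of [u] splits through the iterate of index k + 1: the distance of [u] to that iterate
   and the contracted distance of [u] to iterate k are each at most half of
   [D * (/ 2) ^ k * exp (L * r)], which was made smaller than the defect. *)
assert (E1 := H (S k) r (Rle_refl r)). simpl in E1.
assert (E2 := Hctr u (picard d N a k) (D * (/ 2) ^ k) Huc (Hp k)).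
assert (0 < (/ 2) ^ k) by (apply pow_lt; lra).
specialize (E2 ltac:(nra) (fun s Hs => H k s (proj2 Hs)) r ltac:(lra)).
assert (T : Rabs (u r - (a + rsol d (N u) r)) <= D * (/ 2) ^ k * exp (L * r)).
{ replace (u r - (a + rsol d (N u) r))
    with ((u r - (a + rsol d (N (picard d N a k)) r))
          - (rsol d (N u) r - rsol d (N (picard d N a k)) r)) by ring.
  apply Rabs_le_between in E1. apply Rabs_le_between in E2. apply Rabs_le. lra. }
lra.
Qed.

Lemma rsol_le_plus (d c : R) (f g : R -> R) (r : R) :
  0 < d -> continuity f -> continuity g -> 0 <= r ->
  (forall s, 0 <= s <= r -> f s <= g s + c) ->
  rsol d f r <= rsol d g r + c * r ^ 2 / (2 * d).
Proof.
intros hd Hf Hg Hr H.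
enough (rsol d f r - rsol d g r - c * r ^ 2 / (2 * d)
  <= rsol d f 0 - rsol d g 0 - c * 0 ^ 2 / (2 * d)) as E.
{ rewrite !(rsol_0 d _ 0) in E by lra. lra. }
apply (nonincreasing_of_derive (fun x => rsol d f x - rsol d g x - c * x ^ 2 / (2 * d))
  (fun x => x * avg d f x - x * avg d g x - x * (c / d))); [exact Hr|..].
- intros x Hx.
  apply (is_derive_minus (fun x => rsol d f x - rsol d g x) (fun x => c * x ^ 2 / (2 * d))).
  + apply (is_derive_minus (rsol d f) (rsol d g)); apply is_derive_rsol_pos; auto; lra.
  + auto_derive; [exact I|]. field. lra.
- intros x _. apply continuity_pt_minus.
  + apply continuity_pt_minus; now apply continuity_rsol.
  + eapply is_derive_continuity_pt. auto_derive; [exact I|reflexivity].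
- intros x Hx. assert (avg d f x <= avg d g x + c / d).
  { apply avg_le_plus; auto. intros s Hs. rewrite Rmax_right in Hs by lra.
    apply H. lra. }
  nra.
Qed.

Lemma rsol_nonneg (d : R) (f : R -> R) (r : R) :
  0 < d -> continuity f -> (forall s, 0 <= s <= r -> 0 <= f s) -> 0 <= rsol d f r.
Proof.
intros hd Hf H. destruct (Rle_dec r 0) as [Hr|Hr]; [rewrite rsol_0; lra|].
replace 0 with (0 * r ^ 2 / (2 * d)) by (field; lra).
rewrite <- (rsol_const d 0 r) by lra.
apply rsol_le; auto; [apply continuity_cst|lra].
Qed.

(** * Truncation of the nonlinear terms *)

Definition clamp (M x : R) : R := Rmin M (Rmax 0 x).

Lemma clamp_bounds (M x : R) : 0 <= M -> 0 <= clamp M x <= M.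
Proof.
intros HM. unfold clamp. split; [|apply Rmin_l].
apply Rmin_glb; [exact HM|apply Rmax_l].
Qed.

Lemma clamp_id (M x : R) : 0 <= x <= M -> clamp M x = x.
Proof. intros H. unfold clamp. rewrite Rmax_right, Rmin_right; lra. Qed.

Lemma clamp_neg (M x : R) : 0 <= M -> x <= 0 -> clamp M x = 0.
Proof. intros HM H. unfold clamp. rewrite Rmax_left, Rmin_right; lra. Qed.

Lemma clamp_dist (M x y : R) : Rabs (clamp M x - clamp M y) <= Rabs (x - y).
Proof.
unfold clamp, Rmin, Rmax.
destruct (Rle_dec 0 x), (Rle_dec 0 y); repeat destruct (Rle_dec M _);
unfold Rabs; repeat destruct Rcase_abs; lra.
Qed.

Lemma clamp_abs_le (M x : R) : 0 <= M -> Rabs (clamp M x) <= Rabs x.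
Proof.
intros HM. assert (H := clamp_dist M x 0). rewrite (clamp_neg M 0), !Rminus_0_r in H; lra.
Qed.

Lemma continuity_clamp (M : R) : continuity (clamp M).
Proof.
intros x. apply continuity_pt_intro. intros eps He. exists eps. split; [exact He|].
intros y Hy. apply Rle_lt_trans with (2 := Hy), clamp_dist.
Qed.

Lemma continuity_clamp_comp (M : R) (u : R -> R) :
  continuity u -> continuity (fun s => clamp M (u s)).
Proof. intros Hu. apply (continuity_comp u (clamp M)); [exact Hu|apply continuity_clamp]. Qed.

Lemma continuity_sqr (u : R -> R) : continuity u -> continuity (fun s => u s ^ 2).
Proof.
intros Hu. apply (continuity_comp u (fun x => x ^ 2)); [exact Hu|].
apply derivable_continuous, derivable_pow.
Qed.

Lemma continuity_minus_one_mul (V u : R -> R) :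
  continuity V -> continuity u -> continuity (fun s => (V s - 1) * u s).
Proof.
intros HV Hu. apply continuity_mult; [|exact Hu].
apply continuity_minus; [exact HV|apply continuity_cst].
Qed.

Definition clamped_potential (d M : R) (u : R -> R) : R -> R :=
  rsol d (fun x => clamp M (u x) ^ 2).

(* Truncation makes the solutions global without changing those with values in [0, M]. *)
Definition clamped_force (d M : R) (u : R -> R) (s : R) : R :=
  (clamped_potential d M u s - 1) * clamp M (u s).

Lemma continuity_clamped_potential (d M : R) (u : R -> R) :
  0 < d -> continuity u -> continuity (clamped_potential d M u).
Proof.
intros hd Hu. apply continuity_rsol; [exact hd|].
apply (continuity_sqr (fun x => clamp M (u x))). now apply continuity_clamp_comp.
Qed.

Lemma clamp_sqr_le (M x y : R) :
  0 <= M -> clamp M x ^ 2 <= clamp M y ^ 2 + 2 * M * Rabs (x - y).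
Proof.
intros HM. assert (A := clamp_bounds M x HM). assert (B := clamp_bounds M y HM).
assert (C := clamp_dist M x y). apply Rabs_le_between in C.
assert (Q := Rabs_pos (x - y)).
replace (clamp M x ^ 2) with (clamp M y ^ 2
  + (clamp M x + clamp M y) * (clamp M x - clamp M y)) by ring.
apply Rplus_le_compat_l. nra.
Qed.

Lemma causal_lipschitz_clamped_force (d M : R) :
  0 < d -> 0 <= M -> causal_lipschitz (clamped_force d M).
Proof.
intros hd HM.
assert (Hsq : forall u, continuity u -> continuity (fun x => clamp M (u x) ^ 2)).
{ intros u Hu. apply (continuity_sqr (fun x => clamp M (u x))).
  now apply continuity_clamp_comp. }
split.
{ intros u Hu. apply (continuity_minus_one_mul (clamped_potential d M u)
    (fun s => clamp M (u s))).
  - now apply continuity_clamped_potential.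
  - now apply continuity_clamp_comp. }
intros b Hb. set (q := b ^ 2 / (2 * d)).
assert (Hq : 0 <= q) by (apply Rmult_le_pos; [nra|apply Rlt_le, Rinv_0_lt_compat; lra]).
(* On [0, b] the truncated potential is at most M^2 q, so M^2 q + 1 bounds |V - 1|. The remaining 2
   M^2 q is the Lipschitz constant 2 M of the truncated square, times q from the integration, times
   the bound M of the other factor. *)
exists (M ^ 2 * q + 1 + 2 * M ^ 2 * q). split; [nra|].
intros u w L T Hu Hw HL HT H s Hs.
assert (Hs2 : s ^ 2 / (2 * d) <= q).
{ unfold q. apply Rmult_le_compat_r; [apply Rlt_le, Rinv_0_lt_compat; lra|nra]. }
assert (Hs0 : 0 <= s ^ 2 / (2 * d)).
{ apply Rmult_le_pos; [nra|apply Rlt_le, Rinv_0_lt_compat; lra]. }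
assert (HE : 0 < exp (L * s)) by apply exp_pos.
assert (HV : forall v, continuity v -> 0 <= clamped_potential d M v s <= M ^ 2 * q).
{ intros v Hv. split.
  - apply rsol_nonneg; auto. intros x _. nra.
  - apply Rle_trans with (rsol d (fun _ => M ^ 2) s).
    + apply rsol_le; auto; [apply continuity_cst|lra|].
      intros x _. assert (B := clamp_bounds M (v x) HM). nra.
    + rewrite rsol_const by lra. unfold Rdiv in *. rewrite Rmult_assoc.
      apply Rmult_le_compat_l; nra. }
(* Because the weight increases, the error on all of [0, s] is controlled by its bound at [s]; this
   handles the nonlocal dependence of the potential. *)
assert (HD : forall x, 0 <= x <= s -> Rabs (u x - w x) <= T * exp (L * s)).
{ intros x Hx. apply Rle_trans with (1 := H x ltac:(lra)).
  apply Rmult_le_compat_l; [exact HT|]. apply exp_nondecreasing. nra. }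
assert (HVd : Rabs (clamped_potential d M u s - clamped_potential d M w s)
          <= 2 * M * (T * exp (L * s)) * q).
{ assert (L1 : forall f g, continuity f -> continuity g ->
    (forall x, 0 <= x <= s -> Rabs (f x - g x) <= T * exp (L * s)) ->
    clamped_potential d M f s <= clamped_potential d M g s + 2 * M * (T * exp (L * s)) * q).
  { intros f g Hf Hg Hfg.
    apply Rle_trans with (clamped_potential d M g s
      + 2 * M * (T * exp (L * s)) * s ^ 2 / (2 * d)).
    - apply rsol_le_plus; auto; [lra|]. intros x Hx.
      apply Rle_trans with (1 := clamp_sqr_le M (f x) (g x) HM).
      specialize (Hfg x Hx). nra.
    - apply Rplus_le_compat_l. unfold Rdiv in *. rewrite Rmult_assoc.
      apply Rmult_le_compat_l; [|exact Hs2].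
      apply Rmult_le_pos; [lra|]. apply Rmult_le_pos; lra. }
  apply Rabs_le. split.
  - enough (clamped_potential d M w s <= clamped_potential d M u s
      + 2 * M * (T * exp (L * s)) * q) by lra.
    apply L1; auto. intros x Hx. rewrite Rabs_minus_sym. now apply HD.
  - enough (clamped_potential d M u s <= clamped_potential d M w s
      + 2 * M * (T * exp (L * s)) * q) by lra.
    apply L1; auto. }
assert (Hcd : Rabs (clamp M (u s) - clamp M (w s)) <= T * exp (L * s)).
{ apply Rle_trans with (1 := clamp_dist _ _ _). apply HD. lra. }
assert (Bu := clamp_bounds M (u s) HM). assert (Bw := clamp_bounds M (w s) HM).
assert (Vu := HV u Hu). assert (Vw := HV w Hw).
unfold clamped_force.
replace ((clamped_potential d M u s - 1) * clamp M (u s)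
  - (clamped_potential d M w s - 1) * clamp M (w s))
  with ((clamped_potential d M u s - 1) * (clamp M (u s) - clamp M (w s))
  + (clamped_potential d M u s - clamped_potential d M w s) * clamp M (w s)) by ring.
apply Rle_trans with (1 := Rabs_triang _ _). rewrite !Rabs_mult.
rewrite (Rabs_right (clamp M (w s))) by lra.
assert (A1 : Rabs (clamped_potential d M u s - 1) <= M ^ 2 * q + 1).
{ apply Rabs_le. lra. }
replace ((M ^ 2 * q + 1 + 2 * M ^ 2 * q) * T * exp (L * s)) with
  ((M ^ 2 * q + 1) * (T * exp (L * s)) + 2 * M * (T * exp (L * s)) * q * M) by ring.
apply Rplus_le_compat; apply Rmult_le_compat;
  first [exact A1|exact Hcd|exact HVd|apply Rabs_pos|apply Bw].
Qed.

(** * Uniqueness of the positive decreasing solution *)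

(** The integral form of a positive decreasing solution: [avg] of the force is u'/r, so the last
    clause is u' < 0. Decay at infinity follows from these clauses by [profile_lim]. *)
Definition profile (d u0 : R) (u V : R -> R) : Prop :=
  continuity u /\ continuity V /\ 0 < u0 /\
  (forall r, u r = u0 + rsol d (fun s => (V s - 1) * u s) r) /\
  (forall r, V r = rsol d (fun s => u s ^ 2) r) /\
  (forall r, 0 < r -> 0 < u r) /\
  (forall r, 0 < r -> avg d (fun s => (V s - 1) * u s) r < 0).

Lemma is_derive_affine_rsol (d a : R) (f u : R -> R) (r : R) :
  0 < d -> continuity f -> (forall r, u r = a + rsol d f r) -> 0 <= r ->
  is_derive u r (r * avg d f r).
Proof.
intros hd Hf E Hr. apply (is_derive_ext (fun x => a + rsol d f x)).
- intros t. now rewrite E.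
- eapply is_derive_value.
  + apply (is_derive_plus (fun _ => a) (rsol d f)).
    * apply (is_derive_const a).
    * now apply is_derive_rsol_pos.
  + apply Rplus_0_l.
Qed.

Lemma profile_le (d u0 : R) (u V : R -> R) (r s : R) :
  0 < d -> profile d u0 u V -> r <= s -> u s <= u r.
Proof.
intros hd (Hu & HV & Hu0 & Eu & EV & Hp & Hn) Hrs.
assert (Hf : continuity (fun s => (V s - 1) * u s)) by now apply continuity_minus_one_mul.
assert (D : forall x y, 0 <= x -> x <= y -> u y <= u x).
{ intros x y Hx Hxy.
  apply (nonincreasing_of_derive u (fun x => x * avg d (fun s => (V s - 1) * u s) x)); auto.
  - intros z Hz. apply (is_derive_affine_rsol d u0); auto; lra.
  - intros z Hz. assert (Q := Hn z ltac:(lra)). nra. }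
assert (Z : forall x, x <= 0 -> u x = u 0).
{ intros x Hx. rewrite !Eu, !rsol_0; lra. }
destruct (Rle_dec r 0) as [Hr|Hr].
- rewrite (Z r Hr). destruct (Rle_dec s 0) as [Hs|Hs]; [rewrite (Z s Hs); lra|].
  apply D; lra.
- apply D; lra.
Qed.

Lemma profile_pos (d u0 : R) (u V : R -> R) (r : R) : profile d u0 u V -> 0 < u r.
Proof.
intros (_ & _ & Hu0 & Eu & _ & Hp & _). destruct (Rlt_dec 0 r) as [Hr|Hr]; [now apply Hp|].
rewrite Eu, rsol_0; lra.
Qed.

(* AM-GM gives [(d-1) z / r - c z^2 <= 1/2] beyond [a]. *)
Lemma riccati_bound (d c a b : R) (z dz : R -> R) :
  0 < c -> 0 < a -> a <= b -> (d - 1) ^ 2 <= 2 * c * a ^ 2 ->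
  (forall r, a <= r <= b -> is_derive z r (dz r)) ->
  (forall r, a <= r <= b -> dz r <= - 1 + (d - 1) / r * z r - c * z r ^ 2) ->
  z b <= z a - (b - a) / 2.
Proof.
intros Hc Ha ab Hd D H.
enough (z b + b / 2 <= z a + a / 2) by lra.
apply (nonincreasing_of_derive (fun x => z x + x / 2) (fun x => dz x + / 2)); [exact ab|..].
- intros x Hx. apply (is_derive_plus z (fun x => x / 2)); [apply D; lra|].
  auto_derive; [exact I|]. field.
- intros x Hx. apply continuity_pt_plus.
  + eapply is_derive_continuity_pt. now apply D.
  + eapply is_derive_continuity_pt. auto_derive; [exact I|reflexivity].
- intros x Hx. specialize (H x ltac:(lra)). set (k := (d - 1) / x) in *.
  assert (Hk : k ^ 2 <= 2 * c).
  { unfold k. replace (((d - 1) / x) ^ 2) with ((d - 1) ^ 2 / x ^ 2) by (field; lra).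
    apply (Rmult_le_reg_r (x ^ 2)); [nra|].
    replace ((d - 1) ^ 2 / x ^ 2 * x ^ 2) with ((d - 1) ^ 2) by (field; lra).
    apply Rle_trans with (1 := Hd). apply Rmult_le_compat_l; nra. }
  assert (k * z x - c * z x ^ 2 <= / 2); [|lra].
  apply (Rmult_le_reg_l (4 * c)); [lra|].
  assert (0 <= (2 * c * z x - k) ^ 2) by apply pow2_ge_0. nra.
Qed.

(* If [w 0 < u 0] then [V > W] and [u/w] increases; with [r B] the Wronskian,
   [z = u w / (r B)] satisfies a Riccati inequality forcing it to become negative. *)
Lemma profile_height_not_lt (d u0 w0 : R) (u V w W : R -> R) :
  0 < d -> profile d u0 u V -> profile d w0 w W -> ~ w0 < u0.
Proof.
intros hd Pu Pw Hlt.
assert (Pu' := Pu). assert (Pw' := Pw).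
destruct Pu' as (Hu & HV & Hu0 & Eu & EV & Hup & Hun).
destruct Pw' as (Hw & HW & Hw0 & Ew & EW & Hwp & Hwn).
set (fu := fun s => (V s - 1) * u s) in *. set (fw := fun s => (W s - 1) * w s) in *.
assert (Hfu : continuity fu) by now apply continuity_minus_one_mul.
assert (Hfw : continuity fw) by now apply continuity_minus_one_mul.
assert (Du : forall r, 0 <= r -> is_derive u r (r * avg d fu r)).
{ intros r Hr. now apply (is_derive_affine_rsol d u0). }
assert (Dw : forall r, 0 <= r -> is_derive w r (r * avg d fw r)).
{ intros r Hr. now apply (is_derive_affine_rsol d w0). }
assert (Hu2 := continuity_sqr u Hu). assert (Hw2 := continuity_sqr w Hw).
assert (u_pos : forall r, 0 < u r) by (intros r; exact (profile_pos d u0 u V r Pu)).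
assert (w_pos : forall r, 0 < w r) by (intros r; exact (profile_pos d w0 w W r Pw)).
set (h := fun s => (V s - W s) * (u s * w s)).
assert (Hh : continuity h).
{ unfold h. apply continuity_mult; [now apply continuity_minus|now apply continuity_mult]. }
set (B := fun r => avg d fu r * w r - u r * avg d fw r).
assert (HB : continuity B).
{ unfold B. apply continuity_minus; apply continuity_mult; auto; now apply continuity_avg. }
assert (DB : forall r, 0 < r -> is_derive B r ((h r - d * B r) / r)).
{ intros r Hr. eapply is_derive_value.
  - apply (is_derive_minus (fun r => avg d fu r * w r) (fun r => u r * avg d fw r)).
    + apply (is_derive_mult (avg d fu) w).
      * now apply is_derive_avg.
      * apply Dw. lra.
      * intros a b. apply Rmult_comm.
    + apply (is_derive_mult u (avg d fw)).
      * apply Du. lra.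
      * now apply is_derive_avg.
      * intros a b. apply Rmult_comm.
  - unfold minus, plus, opp, mult, h, B, fu, fw; simpl. field. lra. }
(* [B] obeys the same first-order equation as the average of [h] and is continuous at 0, hence
   equals it; its sign is thus read off from that of V - W. *)
assert (EB : forall r, 0 < r -> B r = avg d h r).
{ destruct (continuity_pt_near B 0 1) as [del [Hdel H]]; [apply HB|lra|].
  apply (avg_unique d h B del (Rabs (B 0) + 1)); auto.
  intros r Hr. assert (Q : Rabs (r - 0) < del) by (rewrite Rminus_0_r, Rabs_right; lra).
  specialize (H r Q). assert (T := Rabs_triang_inv (B r) (B 0)). lra. }
assert (Dq : forall r, 0 <= r -> is_derive (fun x => u x / w x) r (r * B r / w r ^ 2)).
{ intros r Hr. eapply is_derive_value.
  - apply (is_derive_div u w); [now apply Du|now apply Dw|].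
    specialize (w_pos r). lra.
  - unfold B. field. specialize (w_pos r). lra. }
(* Up to a first contact point u >= w, hence V >= W, hence u/w is nondecreasing; but u/w starts
   above 1 and would equal 1 at the contact. *)
assert (Huw : forall r, 0 <= r -> w r < u r).
{ intros r Hr. apply Rnot_le_lt. intros Hn.
  destruct (first_hit (fun x => u x - w x) 0 r 0) as [c [Hc [Ec Hlc]]]; [exact Hr|..].
  - intros x _. now apply continuity_pt_minus.
  - rewrite Eu, Ew, !rsol_0; lra.
  - lra.
  - assert (HVW : forall s, 0 <= s <= c -> W s <= V s).
    { intros s Hs. rewrite EV, EW. apply rsol_le; auto; [lra|].
      intros x Hx. destruct (Rle_lt_or_eq_dec x c) as [xc| ->]; [lra|..].
      - assert (Q := Hlc x ltac:(lra)). assert (Q' := w_pos x). nra.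
      - replace (u c) with (w c) by lra. lra. }
    assert (M : u 0 / w 0 <= u c / w c).
    { apply (nondecreasing_of_derive (fun x => u x / w x) (fun r => r * B r / w r ^ 2)); [lra|..].
      - intros x Hx. apply Dq. lra.
      - intros x Hx. eapply is_derive_continuity_pt. apply Dq. lra.
      - intros x Hx. rewrite EB by lra.
        assert (0 <= avg d h x).
        { replace 0 with (0 / d) by (field; lra). rewrite <- (avg_const d 0 x hd).
          apply avg_le; auto; [apply continuity_cst|].
          intros s Hs. rewrite Rmax_right in Hs by lra. unfold h.
          assert (Q1 := HVW s ltac:(lra)). assert (Q2 := u_pos s). assert (Q3 := w_pos s).
          apply Rmult_le_pos; [lra|nra]. }
        assert (Q3 := w_pos x). apply Rmult_le_pos; [nra|].
        apply Rlt_le, Rinv_0_lt_compat. nra. }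
    replace (u c / w c) with 1 in M
      by (replace (u c) with (w c) by lra; field; assert (Q := w_pos c); lra).
    assert (Q := w_pos 0). assert (u 0 = u0) by (rewrite Eu, rsol_0; lra).
    assert (w 0 = w0) by (rewrite Ew, rsol_0; lra).
    assert (u 0 / w 0 * w 0 <= 1 * w 0) by (apply Rmult_le_compat_r; lra).
    replace (u 0 / w 0 * w 0) with (u 0) in H1 by (field; lra). lra. }
assert (Hav : forall r, 0 < r -> avg d (fun s => w s ^ 2) r < avg d (fun s => u s ^ 2) r).
{ intros r Hr. apply avg_lt; auto. intros s Hs.
  assert (Q := Huw s ltac:(lra)). assert (Q' := w_pos s). nra. }
assert (DV : forall r, 0 <= r -> is_derive (fun x => V x - W x) r
  (r * avg d (fun s => u s ^ 2) r - r * avg d (fun s => w s ^ 2) r)).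
{ intros r Hr. apply (is_derive_minus V W).
  - apply (is_derive_affine_rsol d 0); auto. intros x. rewrite EV. ring.
  - apply (is_derive_affine_rsol d 0); auto. intros x. rewrite EW. ring. }
assert (HVW : forall r s, 0 <= r < s -> V r - W r < V s - W s).
{ intros r s Hrs. apply (increasing_of_derive (fun x => V x - W x) (fun r =>
    r * avg d (fun s => u s ^ 2) r - r * avg d (fun s => w s ^ 2) r)); [lra|..].
  - intros x Hx. apply DV. lra.
  - intros x Hx. eapply is_derive_continuity_pt. apply DV. lra.
  - intros x Hx. assert (Q := Hav x ltac:(lra)). nra. }
assert (HVW0 : V 0 - W 0 = 0) by (rewrite EV, EW, !rsol_0; lra).
(* As V - W increases, this is a positive lower bound for it on [1, oo), where the Riccati
   inequality is used. *)
set (c := V 1 - W 1). assert (Hc : 0 < c) by (assert (Q := HVW 0 1 ltac:(lra)); unfold c; lra).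
assert (HBpos : forall r, 0 < r -> 0 < B r).
{ intros r Hr. rewrite EB by exact Hr. replace 0 with (0 / d) by (field; lra).
  rewrite <- (avg_const d 0 r hd). apply avg_lt; auto; [apply continuity_cst|].
  intros s Hs. unfold h. assert (Q := HVW 0 s ltac:(lra)).
  assert (Q2 := u_pos s). assert (Q3 := w_pos s).
  apply Rmult_lt_0_compat; [lra|nra]. }
(* This is the reciprocal of delta: instead of a blow-up, the contradiction is a sign change of a
   function defined at all positive radii. *)
set (z := fun r => u r * w r / (r * B r)).
set (dz := fun r => avg d fu r * w r / B r + u r * avg d fw r / B r
   - u r * w r * (B r + (h r - d * B r)) / (r * B r) ^ 2).
assert (Dz : forall r, 0 < r -> is_derive z r (dz r)).
{ intros r Hr. assert (Q := HBpos r Hr). eapply is_derive_value.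
  - apply (is_derive_div (fun r => u r * w r) (fun r => r * B r)).
    + apply (is_derive_mult u w); [apply Du; lra|apply Dw; lra|].
      intros a b. apply Rmult_comm.
    + apply (is_derive_mult (fun r => r) B); [apply is_derive_id|now apply DB|].
      intros a b. apply Rmult_comm.
    + nra.
  - unfold dz, plus, mult, one; simpl. field. lra. }
assert (Hz : forall r, 1 <= r -> dz r <= - 1 + (d - 1) / r * z r - c * z r ^ 2).
{ intros r Hr. assert (Q := HBpos r ltac:(lra)). assert (Q2 := u_pos r). assert (Q3 := w_pos r).
  assert (Qu := Hun r ltac:(lra)).
  (* The last term is 2 z u'/u, which is nonpositive because [u] decreases. *)
  assert (E : dz r = - 1 + (d - 1) / r * z r - (V r - W r) * z r ^ 2
              + 2 * (avg d fu r * w r / B r)).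
  { unfold dz, z, h.
    replace (u r * avg d fw r) with (avg d fu r * w r - B r) by (unfold B; ring).
    field. lra. }
  rewrite E.
  assert (X1 : c <= V r - W r).
  { destruct Hr as [Hr| <-]; [|unfold c; lra].
    assert (Q4 := HVW 1 r ltac:(lra)). unfold c. lra. }
  assert (X2 : 0 <= z r ^ 2) by apply pow2_ge_0.
  assert (X3 : avg d fu r * w r / B r <= 0).
  { assert (0 < / B r) by now apply Rinv_0_lt_compat.
    assert (0 < - avg d fu r * w r) by (apply Rmult_lt_0_compat; lra).
    unfold Rdiv. nra. }
  nra. }
(* A square-root-free choice with (d-1)^2 <= 2 c a^2: for t = 1/(2c) one has (1 + t)^2 >= 2 t, so 2
   c a^2 >= 2 (d-1)^2. *)
set (a := 1 + Rabs (d - 1) * (1 + / (2 * c))).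
assert (Hi : 0 < / (2 * c)) by (apply Rinv_0_lt_compat; lra).
assert (Ha : 1 <= a) by (unfold a; assert (Q := Rabs_pos (d - 1)); nra).
assert (Hac : (d - 1) ^ 2 <= 2 * c * a ^ 2).
{ rewrite <- (pow2_abs (d - 1)). assert (Q := Rabs_pos (d - 1)).
  assert (Q1 : 2 * c * / (2 * c) = 1) by (field; lra).
  assert (Q2 : Rabs (d - 1) ^ 2 * (1 + / (2 * c)) ^ 2 <= a ^ 2).
  { rewrite <- Rpow_mult_distr. apply pow_incr. unfold a. nra. }
  assert (Q3 : 2 * / (2 * c) <= (1 + / (2 * c)) ^ 2) by nra.
  assert (Q4 : Rabs (d - 1) ^ 2 * (2 * / (2 * c)) <= a ^ 2).
  { apply Rle_trans with (2 := Q2). apply Rmult_le_compat_l; [nra|exact Q3]. }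
  assert (Q5 : 2 * c * (Rabs (d - 1) ^ 2 * (2 * / (2 * c))) <= 2 * c * a ^ 2).
  { apply Rmult_le_compat_l; lra. }
  replace (2 * c * (Rabs (d - 1) ^ 2 * (2 * / (2 * c))))
    with (2 * Rabs (d - 1) ^ 2) in Q5 by (field; lra).
  nra. }
(* [riccati_bound] makes [z] fall by at least (b - a)/2 = z(a) over [a, b], so z(b) <= 0. *)
set (b := a + 2 * z a).
assert (Zpos : forall r, 0 < r -> 0 < z r).
{ intros r Hr. assert (Q := HBpos r Hr). assert (Q2 := u_pos r). assert (Q3 := w_pos r).
  apply Rdiv_lt_0_compat; nra. }
assert (Q := Zpos a ltac:(lra)).
assert (Hb : a <= b) by (unfold b; lra).
assert (F := riccati_bound d c a b z dz Hc ltac:(lra) Hb Hac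
  (fun r Hr => Dz r ltac:(lra)) (fun r Hr => Hz r ltac:(lra))).
assert (Q' := Zpos b ltac:(lra)). unfold b in F at 2. lra.
Qed.

(** A profile takes values in ]0, u0] on the half-line, so truncation at its own initial value
    changes nothing. Profiles with equal initial value therefore coincide by uniqueness of the fixed
    point. *)
Lemma profile_clamped (d u0 : R) (u V : R -> R) :
  0 < d -> profile d u0 u V -> radial_fixpoint d (clamped_force d u0) u0 u.
Proof.
intros hd P. assert (P' := P). destruct P' as (Hu & HV & Hu0 & Eu & EV & Hup & Hun).
split; [exact Hu|]. intros r. rewrite Eu. f_equal.
assert (Hr : forall s, 0 <= s -> clamp u0 (u s) = u s).
{ intros s Hs. apply clamp_id. split.
  - apply Rlt_le. exact (profile_pos d u0 u V s P).
  - assert (Q := profile_le d u0 u V 0 s hd P Hs).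
    rewrite (Eu 0), (rsol_0 d _ 0) in Q by lra. lra. }
apply rsol_ext; auto.
- now apply continuity_minus_one_mul.
- now apply (proj1 (causal_lipschitz_clamped_force d u0 hd ltac:(lra))).
- intros s Hs. unfold clamped_force. rewrite Hr by exact Hs. rewrite EV.
  do 2 f_equal. apply rsol_ext; auto.
  + now apply continuity_sqr.
  + apply (continuity_sqr (fun x => clamp u0 (u x))). now apply continuity_clamp_comp.
  + intros x Hx. now rewrite Hr.
Qed.

Lemma profile_unique (d u0 w0 : R) (u V w W : R -> R) :
  0 < d -> profile d u0 u V -> profile d w0 w W ->
  w0 = u0 /\ forall r, w r = u r /\ W r = V r.
Proof.
intros hd Pu Pw.
assert (E : w0 = u0).
{ destruct (Rtotal_order w0 u0) as [L|[L|L]]; [|exact L|]; exfalso.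
  - exact (profile_height_not_lt d u0 w0 u V w W hd Pu Pw L).
  - exact (profile_height_not_lt d w0 u0 w W u V hd Pw Pu L). }
subst w0. split; [reflexivity|].
assert (H : forall r, w r = u r).
{ apply (radial_fixpoint_unique d (clamped_force d u0) u0); auto.
  - apply causal_lipschitz_clamped_force; [exact hd|]. apply Rlt_le, Pu.
  - now apply (profile_clamped d u0 w W).
  - now apply (profile_clamped d u0 u V). }
intros r. split; [apply H|].
destruct Pu as (Hu & _ & _ & _ & EV & _). destruct Pw as (Hw & _ & _ & _ & EW & _).
rewrite EV, EW. apply rsol_ext; auto using continuity_sqr.
intros s _. now rewrite H.
Qed.

(** * Existence by shooting *)

(** The average has the sign of the integral [wint], which does not increase while [f <= 0]. In
    terms of solutions: a negative slope stays negative as long as the force is nonpositive. *)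
Lemma avg_neg_persist (d : R) (f : R -> R) (r s : R) :
  0 < d -> continuity f -> 0 < r -> r <= s ->
  (forall x, r < x < s -> f x <= 0) -> avg d f r < 0 -> avg d f s < 0.
Proof.
intros hd Hf Hr Hrs H Hn.
assert (W := wint_incr_le d f (fun _ => 0) r s hd Hf
  (continuity_cst 0) (Rlt_le _ _ Hr) Hrs H).
rewrite !wint_const, !avg_wint in W by lra.
assert (P1 := rpow_pos d r Hr). assert (P2 := rpow_pos d s ltac:(lra)).
assert (0 < d * rpow d r) by (apply Rmult_lt_0_compat; lra).
assert (d * rpow d r * avg d f r < 0) by nra.
apply Rnot_le_lt. intros Hp. assert (0 <= d * rpow d s * avg d f s); [|lra].
apply Rmult_le_pos; [apply Rmult_le_pos; lra|exact Hp].
Qed.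

Lemma avg_pos_persist (d : R) (f : R -> R) (r s : R) :
  0 < d -> continuity f -> 0 < r -> r <= s ->
  (forall x, r < x < s -> 0 <= f x) -> 0 < avg d f r -> 0 < avg d f s.
Proof.
intros hd Hf Hr Hrs H Hn.
assert (W := wint_incr_le d (fun _ => 0) f r s hd
  (continuity_cst 0) Hf (Rlt_le _ _ Hr) Hrs H).
rewrite !wint_const, !avg_wint in W by lra.
assert (P1 := rpow_pos d r Hr). assert (P2 := rpow_pos d s ltac:(lra)).
assert (0 < d * rpow d r) by (apply Rmult_lt_0_compat; lra).
assert (0 < d * rpow d r * avg d f r) by nra.
apply Rnot_le_lt. intros Hp. assert (d * rpow d s * avg d f s <= 0); [|lra].
assert (0 < d * rpow d s) by (apply Rmult_lt_0_compat; lra). nra.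
Qed.

Lemma avg_pos_of_nonneg (d : R) (f : R -> R) (r s : R) :
  0 < d -> continuity f -> 0 < r -> r < s ->
  (forall x, r < x < s -> 0 < f x) -> 0 <= avg d f r -> 0 < avg d f s.
Proof.
intros hd Hf Hr Hrs H Hn.
assert (W := wint_incr_lt d (fun _ => 0) f r s hd
  (continuity_cst 0) Hf (Rlt_le _ _ Hr) Hrs H).
rewrite !wint_const, !avg_wint in W by lra.
assert (P1 := rpow_pos d r Hr). assert (P2 := rpow_pos d s ltac:(lra)).
assert (0 <= d * rpow d r * avg d f r) by (apply Rmult_le_pos; [apply Rmult_le_pos; lra|exact Hn]).
apply Rnot_le_lt. intros Hp. assert (d * rpow d s * avg d f s <= 0); [|lra].
assert (0 < d * rpow d s) by (apply Rmult_lt_0_compat; lra). nra.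
Qed.

Lemma avg_nonpos (d : R) (f : R -> R) (r : R) :
  0 < d -> continuity f -> 0 < r ->
  (forall s, 0 <= s <= r -> f s <= 0) -> avg d f r <= 0.
Proof.
intros hd Hf Hr H. replace 0 with (0 / d) by (field; lra).
rewrite <- (avg_const d 0 r hd). apply avg_le; auto; [apply continuity_cst|].
intros s Hs. rewrite Rmax_right in Hs by lra. now apply H.
Qed.

Lemma avg_neg (d : R) (f : R -> R) (r : R) :
  0 < d -> continuity f -> 0 < r ->
  (forall s, 0 < s < r -> f s < 0) -> avg d f r < 0.
Proof.
intros hd Hf Hr H. replace 0 with (0 / d) by (field; lra).
rewrite <- (avg_const d 0 r hd). apply avg_lt; auto. apply continuity_cst.
Qed.

Lemma avg_nonneg (d : R) (f : R -> R) (r : R) :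
  0 < d -> continuity f -> 0 < r ->
  (forall s, 0 <= s <= r -> 0 <= f s) -> 0 <= avg d f r.
Proof.
intros hd Hf Hr H. replace 0 with (0 / d) by (field; lra).
rewrite <- (avg_const d 0 r hd). apply avg_le; auto; [apply continuity_cst|].
intros s Hs. rewrite Rmax_right in Hs by lra. now apply H.
Qed.

Lemma avg_pos (d : R) (f : R -> R) (r : R) :
  0 < d -> continuity f -> 0 < r ->
  (forall s, 0 < s < r -> 0 < f s) -> 0 < avg d f r.
Proof.
intros hd Hf Hr H. replace 0 with (0 / d) by (field; lra).
rewrite <- (avg_const d 0 r hd). apply avg_lt; auto. apply continuity_cst.
Qed.

(** By continuity [f] is negative on a short interval at the origin, where the average is negative;
    then the sign persists. *)
Lemma avg_neg_of_nonpos (d : R) (f : R -> R) (r : R) :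
  0 < d -> continuity f -> 0 < r -> f 0 < 0 ->
  (forall s, 0 <= s <= r -> f s <= 0) -> avg d f r < 0.
Proof.
intros hd Hf Hr H0 H.
destruct (continuity_pt_near f 0 (- f 0) (Hf 0) ltac:(lra)) as [del [Hdel Hnear]].
assert (He : 0 < Rmin r del) by (apply Rmin_pos; lra).
assert (Q := Rmin_l r del). assert (Q' := Rmin_r r del).
apply (avg_neg_persist d f (Rmin r del)); auto.
- intros x Hx. apply H. lra.
- apply avg_neg; auto. intros s Hs.
  assert (Q2 := Hnear s ltac:(rewrite Rminus_0_r, Rabs_right; lra)).
  apply Rabs_def2 in Q2. lra.
Qed.

Section Shooting.

Variables (d M : R).
Hypothesis hd : 0 < d.
Hypothesis hM : 0 < M.

(** The level [M] does not vary with the initial value [a], so all shots solve one equation and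
    [radial_fixpoint_dependence] compares them. *)
Let shot := radial_fixpoint d (clamped_force d M).
Let F := clamped_force d M.
Let V := clamped_potential d M.

Lemma continuity_clamped_force (u : R -> R) : continuity u -> continuity (F u).
Proof. apply (causal_lipschitz_clamped_force d M hd (Rlt_le _ _ hM)). Qed.

Lemma continuity_clamp_sqr (u : R -> R) :
  continuity u -> continuity (fun s => clamp M (u s) ^ 2).
Proof.
intros Hu. apply (continuity_sqr (fun s => clamp M (u s))).
now apply continuity_clamp_comp.
Qed.

Lemma is_derive_shot (a r : R) (u : R -> R) :
  shot a u -> 0 <= r -> is_derive u r (r * avg d (F u) r).
Proof.
intros [Hu E] Hr. apply (is_derive_affine_rsol d a); auto.
now apply continuity_clamped_force.
Qed.

Lemma shot_0 (a r : R) (u : R -> R) : shot a u -> r <= 0 -> u r = a.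
Proof. intros [Hu E] Hr. rewrite E, rsol_0; lra. Qed.

Lemma shot_nonincreasing_on (a x y : R) (u : R -> R) :
  shot a u -> 0 <= x -> x <= y ->
  (forall s, x < s < y -> avg d (F u) s <= 0) -> u y <= u x.
Proof.
intros Hs Hx Hxy H.
apply (nonincreasing_of_derive u (fun r => r * avg d (F u) r)); auto.
- intros z Hz. apply (is_derive_shot a); auto. lra.
- intros z _. apply Hs.
- intros z Hz. specialize (H z Hz). nra.
Qed.

Lemma clamped_potential_0 (u : R -> R) (r : R) : r <= 0 -> V u r = 0.
Proof. exact (rsol_0 d (fun x => clamp M (u x) ^ 2) r). Qed.

Lemma is_derive_clamped_potential (u : R -> R) (r : R) :
  continuity u -> 0 <= r ->
  is_derive (V u) r (r * avg d (fun s => clamp M (u s) ^ 2) r).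
Proof.
intros Hu Hr. unfold V, clamped_potential. apply is_derive_rsol_pos; auto. now apply continuity_clamp_sqr.
Qed.

Lemma clamped_potential_le (u : R -> R) (r s : R) :
  continuity u -> 0 <= r -> r <= s -> V u r <= V u s.
Proof.
intros Hu Hr Hrs.
apply (nondecreasing_of_derive _ (fun x => x * avg d (fun s => clamp M (u s) ^ 2) x)); auto.
- intros x Hx. apply is_derive_clamped_potential; auto. lra.
- intros x _. now apply continuity_clamped_potential.
- intros x Hx. apply Rmult_le_pos; [lra|]. apply avg_nonneg; [exact hd| |lra|].
  + now apply continuity_clamp_sqr.
  + intros y _. apply pow2_ge_0.
Qed.

Lemma clamped_force_nonpos (u : R -> R) (s : R) : V u s <= 1 -> F u s <= 0.
Proof.
intros H. unfold F, clamped_force. fold V.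
assert (B := clamp_bounds M (u s) (Rlt_le _ _ hM)). nra.
Qed.

Lemma clamped_force_nonneg (u : R -> R) (s : R) : 1 <= V u s -> 0 <= F u s.
Proof.
intros H. unfold F, clamped_force. fold V.
assert (B := clamp_bounds M (u s) (Rlt_le _ _ hM)). nra.
Qed.

Lemma clamped_force_0 (u : R -> R) (s : R) : u s <= 0 -> F u s = 0.
Proof. intros H. unfold F, clamped_force. rewrite clamp_neg; lra. Qed.

Lemma avg_force_nonpos_of_potential (u : R -> R) (r : R) :
  continuity u -> 0 < r -> V u r <= 1 -> avg d (F u) r <= 0.
Proof.
intros Hu Hr H. apply avg_nonpos; auto using continuity_clamped_force.
intros s Hs. apply clamped_force_nonpos. apply Rle_trans with (2 := H).
apply clamped_potential_le; auto; lra.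
Qed.

(* Once negative with negative slope, the shot has zero force and never
   returns; a positive slope would need [V > 1] and then persist. *)
Lemma negative_shot_nonincreasing (a r2 : R) (u : R -> R) :
  shot a u -> 0 < a -> 0 < r2 -> u r2 < 0 ->
  forall r, 0 < r -> avg d (F u) r <= 0.
Proof.
intros Hs Ha Hr2 Hneg r1 Hr1. apply Rnot_lt_le. intros Hpos.
assert (Hu : continuity u) by apply Hs.
assert (HF := continuity_clamped_force u Hu).
assert (HV1 : 1 < V u r1).
{ apply Rnot_le_lt. intros Hn.
  assert (Q := avg_force_nonpos_of_potential u r1 Hu Hr1 Hn). lra. }
assert (Hup : forall r, r1 <= r -> 0 < avg d (F u) r).
{ intros r Hr. apply (avg_pos_persist d (F u) r1); auto.
  intros x Hx. apply clamped_force_nonneg.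
  assert (Q := clamped_potential_le u r1 x Hu ltac:(lra) ltac:(lra)). lra. }
(* A negative value at or before [r1]: if [r2] lies beyond [r1], then [u] increases from [r1] to
   [r2] and is already negative at [r1]. *)
assert (Hr3 : exists r3, 0 < r3 <= r1 /\ u r3 < 0).
{ destruct (Rle_dec r2 r1) as [L|L]; [exists r2; lra|].
  exists r1. split; [lra|]. apply Rle_lt_trans with (2 := Hneg).
  apply (nondecreasing_of_derive u (fun r => r * avg d (F u) r)); [lra|..].
  - intros z Hz. apply (is_derive_shot a); auto. lra.
  - intros z _. apply Hu.
  - intros z Hz. assert (Q := Hup z ltac:(lra)). nra. }
destruct Hr3 as [r3 [Hr3 Hu3]].
(* Reversing time from [r3] turns the first hit into the last zero [r3 - c] before [r3]. Between the
   two [u] is negative, and the mean value theorem gives a point with negative slope there. *)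
destruct (first_hit (fun x => - u (r3 - x)) 0 r3 0) as [c [Hc [Ec Hlc]]]; [lra|..].
{ intros x _. apply continuity_pt_opp.
  apply (continuity_pt_comp (fun x => r3 - x) u); [|apply Hu].
  apply continuity_pt_minus; [apply continuity_cst|].
  apply derivable_continuous_pt, derivable_pt_id. }
{ rewrite Rminus_0_r. lra. }
{ rewrite Rminus_diag, (shot_0 a _ u Hs) by lra. lra. }
destruct (mean_value u (fun r => r * avg d (F u) r) (r3 - c) r3) as [s [Hs1 Hs2]]; [lra|..].
{ intros x Hx. apply (is_derive_shot a); auto. lra. }
{ intros x _. apply Hu. }
assert (Hus : u s < 0).
{ assert (Q := Hlc (r3 - s) ltac:(lra)). replace (r3 - (r3 - s)) with s in Q by ring. lra. }
assert (Has : avg d (F u) s < 0).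
{ apply Rnot_le_lt. intros Hn.
  assert (0 <= s * avg d (F u) s) by (apply Rmult_le_pos; lra). nra. }
assert (Hlast : forall t, s <= t -> u t < 0).
{ intros t Ht. apply Rnot_le_lt. intros Hn.
  destruct (first_hit (fun x => - u x) s t 0) as [e [He [Ee Hle]]]; [lra| |lra|lra|].
  { intros x _. apply continuity_pt_opp, Hu. }
  assert (u e <= u s); [|lra].
  apply (shot_nonincreasing_on a); auto; [lra|lra|].
  intros x Hx. apply Rlt_le, (avg_neg_persist d (F u) s); auto; [lra|lra|].
  intros y Hy. rewrite clamped_force_0; [lra|]. assert (Q := Hle y ltac:(lra)). lra. }
assert (avg d (F u) r1 < 0); [|lra].
apply (avg_neg_persist d (F u) s); auto; [lra|lra|].
intros y Hy. rewrite clamped_force_0; [lra|]. assert (Q := Hlast y ltac:(lra)). lra.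
Qed.

(** Serves to integrate the quadratic lower bound of the force in [top_shot_positive]; the inner
    average is identified by its first-order equation. *)
Lemma rsol_quadratic (k m r : R) : 0 <= r ->
  rsol d (fun s => k * s ^ 2 - m) r = k * r ^ 4 / (4 * (d + 2)) - m * r ^ 2 / (2 * d).
Proof.
intros Hr.
assert (C : continuity (fun s => k * s ^ 2 - m)).
{ intros x. eapply is_derive_continuity_pt. auto_derive; [exact I|reflexivity]. }
assert (A : forall x, 0 < x -> k * x ^ 2 / (d + 2) - m / d = avg d (fun s => k * s ^ 2 - m) x).
{ apply (avg_unique d _ (fun x => k * x ^ 2 / (d + 2) - m / d) 1
    (Rabs (k / (d + 2)) + Rabs (m / d))); [exact hd|exact C|lra|..].
  - intros x Hx. apply Rle_trans with (1 := Rabs_triang _ _). rewrite Rabs_Ropp.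
    apply Rplus_le_compat_r.
    replace (k * x ^ 2 / (d + 2)) with (k / (d + 2) * x ^ 2) by (field; lra).
    rewrite Rabs_mult, (Rabs_right (x ^ 2)) by nra.
    assert (Q := Rabs_pos (k / (d + 2))).
    assert (Q' : x ^ 2 <= 1) by nra. nra.
  - intros x Hx. auto_derive; [exact I|]. field. lra. }
rewrite (rsol_eq_of_derive d (fun s => k * s ^ 2 - m)
  (fun r => k * r ^ 4 / (4 * (d + 2)) - m * r ^ 2 / (2 * d)) hd C); auto.
- field. lra.
- intros x. eapply is_derive_continuity_pt. auto_derive; [exact I|reflexivity].
- intros x Hx. rewrite <- A by exact Hx. auto_derive; [exact I|]. field. lra.
Qed.

(** While u >= M/2, the potential is at least M^2 s^2 / (8 d), so the force is at least k s^2 - M.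
    Integrating up to a first contact [c] with M/2 and putting y = c^2/d, the choice of [M] (that
    is, d/(d+2) = 8/M) turns the bound into u(c) >= M + M (M y^2/8 - y/2). The last bracket exceeds
    -1/2 because M > 1, so u(c) > M/2, a contradiction. *)
Lemma top_shot_positive (u : R -> R) :
  M = 8 * (d + 2) / d -> shot M u -> forall r, 0 <= r -> M / 2 < u r.
Proof.
intros EM Hs r Hr. apply Rnot_le_lt. intros Hn.
assert (Hu : continuity u) by apply Hs.
destruct (first_hit u 0 r (M / 2)) as [c [Hc [Ec Hlc]]]; [exact Hr| | |exact Hn|].
{ intros x _. apply Hu. }
{ rewrite (shot_0 M _ u Hs) by lra. lra. }
assert (Hge : forall s, 0 <= s <= c -> M / 2 <= clamp M (u s) <= M).
{ intros s Hs'. assert (M / 2 <= u s).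
  { destruct (Rlt_dec s c) as [L|L]; [apply Rlt_le, Hlc; lra|].
    replace s with c by lra. lra. }
  split; [|now apply clamp_bounds, Rlt_le].
  unfold clamp. apply Rmin_glb; [lra|]. apply Rle_trans with (1 := H), Rmax_r. }
set (k := M ^ 3 / (16 * d)).
assert (HF : forall s, 0 <= s <= c -> k * s ^ 2 - M <= F u s).
{ intros s Hs'. assert (Q := Hge s Hs').
  assert (HVs : M ^ 2 / 4 * s ^ 2 / (2 * d) <= V u s).
  { rewrite <- rsol_const by lra. unfold V, clamped_potential. apply rsol_le; [exact hd|apply continuity_cst|..].
    - now apply continuity_clamp_sqr.
    - lra.
    - intros x Hx. assert (Q' := Hge x ltac:(lra)). nra. }
  unfold F, clamped_force. fold V.
  assert (P0 : 0 <= M ^ 2 / 4 * s ^ 2 / (2 * d)).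
  { apply Rmult_le_pos; [nra|]. apply Rlt_le, Rinv_0_lt_compat. lra. }
  assert (P1 : M ^ 2 / 4 * s ^ 2 / (2 * d) * (M / 2) <= V u s * clamp M (u s)).
  { apply Rmult_le_compat; lra. }
  replace (k * s ^ 2) with (M ^ 2 / 4 * s ^ 2 / (2 * d) * (M / 2)) by (unfold k; field; lra).
  lra. }
assert (L : k * c ^ 4 / (4 * (d + 2)) - M * c ^ 2 / (2 * d) <= rsol d (F u) c).
{ rewrite <- rsol_quadratic by lra. apply rsol_le; auto; [|now apply continuity_clamped_force|lra].
  intros x. eapply is_derive_continuity_pt. auto_derive; [exact I|reflexivity]. }
assert (E := proj2 Hs c). rewrite Ec in E. fold F in E.
set (y := c ^ 2 / d).
assert (E1 : k * c ^ 4 / (4 * (d + 2)) - M * c ^ 2 / (2 * d) = M * (M * y ^ 2 / 8 - y / 2)).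
{ unfold k, y. replace (M ^ 3) with (M * M * M) by ring. rewrite EM at 1. field. lra. }
rewrite E1 in L.
assert (HM8 : 8 < M).
{ rewrite EM. apply (Rmult_lt_reg_r d); [exact hd|].
  replace (8 * (d + 2) / d * d) with (8 * (d + 2)) by (field; lra). lra. }
assert (- / 2 < M * y ^ 2 / 8 - y / 2) by nra.
nra.
Qed.

(** Suppose the shot stays nonnegative. The smallness of [a] keeps V <= 1/2 on [0, d + 6], so the
    force is at most -u/2 there, and z = -u/u' satisfies a Riccati inequality that drives it below 0
    before d + 6, although it is nonnegative. *)
Lemma small_shot_negative (a : R) (u : R -> R) :
  0 < a <= M -> a ^ 2 * (d + 6) ^ 2 <= d -> shot a u -> exists r, 0 < r /\ u r < 0.
Proof.
intros Ha Hab Hs. apply NNPP. intros Hno.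
assert (Hnn : forall r, 0 <= u r).
{ intros r. apply Rnot_lt_le. intros Hr. apply Hno. exists r. split; [|exact Hr].
  apply Rnot_le_lt. intros L. rewrite (shot_0 a _ u Hs) in Hr by exact L. lra. }
clear Hno. assert (Hu : continuity u) by apply Hs.
assert (HF := continuity_clamped_force u Hu).
set (b := d + 6) in *.
assert (Hle : forall c, 0 <= c -> V u c <= 1 -> forall s t, 0 <= s -> s <= t -> t <= c -> u t <= u s).
{ intros c Hc HVc s t Hs' Hst Htc. apply (shot_nonincreasing_on a); auto.
  intros x Hx. apply avg_force_nonpos_of_potential; auto; [lra|].
  apply Rle_trans with (2 := HVc). apply clamped_potential_le; auto; lra. }
assert (Hhalf : forall c, 0 <= c <= b -> V u c <= 1 -> V u c <= / 2).
{ intros c Hc HVc. apply Rle_trans with (rsol d (fun _ => a ^ 2) c).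
  - unfold V, clamped_potential. apply rsol_le; auto; [now apply continuity_clamp_sqr|apply continuity_cst|lra|].
    intros s Hs'. assert (Q := Hle c ltac:(lra) HVc 0 s ltac:(lra) ltac:(lra) ltac:(lra)).
    rewrite (shot_0 a 0 u Hs) in Q by lra.
    rewrite clamp_id by (split; [apply Hnn|lra]).
    apply pow_incr. split; [apply Hnn|exact Q].
  - rewrite rsol_const by lra. apply (Rmult_le_reg_r (2 * d)); [lra|].
    replace (a ^ 2 * c ^ 2 / (2 * d) * (2 * d)) with (a ^ 2 * c ^ 2) by (field; lra).
    assert (c ^ 2 <= b ^ 2) by (apply pow_incr; lra).
    assert (0 <= a ^ 2) by nra. nra. }
(* The bound V <= 1 improves itself to V <= 1/2, so the continuous function V, starting at 0, never
   reaches 1 on [0, b]. *)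
assert (HV : forall c, 0 <= c <= b -> V u c <= / 2).
{ intros c Hc. apply Hhalf; [exact Hc|]. apply Rnot_lt_le. intros Hn.
  destruct (first_hit (fun x => - V u x) 0 c (- 1)) as [e [He [Ee _]]]; [lra|..].
  - intros x _. apply continuity_pt_opp. now apply continuity_clamped_potential.
  - rewrite clamped_potential_0; lra.
  - lra.
  - assert (V u e <= / 2) by (apply Hhalf; lra). lra. }
assert (Hmono : forall s t, 0 <= s -> s <= t -> t <= b -> u t <= u s).
{ apply Hle; [unfold b; lra|]. assert (Q := HV b ltac:(unfold b; lra)). lra. }
assert (Hfu : forall s, 0 <= s <= b -> F u s <= - (u s / 2)).
{ intros s Hs'. unfold F, clamped_force. fold V.
  assert (Q := Hmono 0 s ltac:(lra) ltac:(lra) ltac:(lra)).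
  rewrite (shot_0 a 0 u Hs) in Q by lra.
  rewrite clamp_id by (split; [apply Hnn|lra]).
  assert (Q1 := HV s Hs'). assert (Q2 := Hnn s). nra. }
assert (Hneg : forall r, 0 < r <= b -> avg d (F u) r < 0).
{ intros r Hr. apply avg_neg_of_nonpos; auto; [lra|..].
  - assert (Q := Hfu 0 ltac:(lra)). rewrite (shot_0 a 0 u Hs) in Q by lra. lra.
  - intros s Hs'. assert (Q := Hfu s ltac:(lra)). assert (Q' := Hnn s). lra. }
set (z := fun r => - u r / (r * avg d (F u) r)).
set (dz := fun r => - 1 + (d - 1) / r * z r + u r * F u r / (r * avg d (F u) r) ^ 2).
assert (Dz : forall r, 0 < r <= b -> is_derive z r (dz r)).
{ intros r Hr. assert (Q := Hneg r Hr). eapply is_derive_value.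
  - apply (is_derive_div (fun r => - u r) (fun r => r * avg d (F u) r)).
    + apply (is_derive_opp u). apply (is_derive_shot a); auto. lra.
    + apply is_derive_r_avg; auto. lra.
    + nra.
  - unfold dz, z, opp; simpl. field. lra. }
assert (Hz : forall r, 0 < r <= b -> dz r <= - 1 + (d - 1) / r * z r - / 2 * z r ^ 2).
{ intros r Hr. assert (Q := Hneg r Hr). unfold dz.
  enough (u r * F u r / (r * avg d (F u) r) ^ 2 <= - (/ 2 * z r ^ 2)) by lra.
  replace (- (/ 2 * z r ^ 2)) with (u r * (- (u r / 2)) / (r * avg d (F u) r) ^ 2)
    by (unfold z; field; lra).
  apply Rmult_le_compat_r.
  - apply Rlt_le, Rinv_0_lt_compat. apply pow2_gt_0. nra.
  - assert (Q1 := Hnn r). assert (Q2 := Hfu r ltac:(lra)). nra. }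
(* Starting at d + 1 meets the condition (d-1)^2 <= 2 c a^2 for c = 1/2. The interval has length 5,
   so [z] drops by 5/2, more than its initial value, which is at most 2d/(d+1) < 2. *)
assert (R1 := riccati_bound d (/ 2) (d + 1) b z dz ltac:(lra) ltac:(lra)
  ltac:(unfold b; lra) ltac:(nra) (fun r Hr => Dz r ltac:(lra)) (fun r Hr => Hz r ltac:(lra))).
assert (R2 : z (d + 1) <= 2).
{ assert (Q := Hneg (d + 1) ltac:(unfold b; lra)).
  assert (Q1 : avg d (F u) (d + 1) <= - (u (d + 1) / 2) / d).
  { rewrite <- (avg_const d _ (d + 1) hd). apply avg_le; auto; [apply continuity_cst|].
    intros s Hs'. rewrite Rmax_right in Hs' by lra.
    assert (Q1 := Hfu s ltac:(unfold b; lra)).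
    assert (Q2 := Hmono s (d + 1) ltac:(lra) ltac:(lra) ltac:(unfold b; lra)). lra. }
  set (A := avg d (F u) (d + 1)) in *.
  assert (Q2 : d * A <= - (u (d + 1) / 2)).
  { apply Rmult_le_compat_l with (r := d) in Q1; [|lra].
    replace (d * (- (u (d + 1) / 2) / d)) with (- (u (d + 1) / 2)) in Q1 by (field; lra).
    exact Q1. }
  unfold z. fold A. apply (Rmult_le_reg_r (- ((d + 1) * A))); [nra|].
  replace (- u (d + 1) / ((d + 1) * A) * - ((d + 1) * A)) with (u (d + 1)) by (field; lra).
  nra. }
assert (R3 : 0 <= z b).
{ assert (Q := Hneg b ltac:(unfold b; lra)). unfold z.
  replace (- u b / (b * avg d (F u) b)) with (u b * / (b * - avg d (F u) b))
    by (field; unfold b in *; lra).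
  apply Rmult_le_pos; [apply Hnn|]. apply Rlt_le, Rinv_0_lt_compat.
  apply Rmult_lt_0_compat; [unfold b|]; lra. }
unfold b in R1, R3. lra.
Qed.

(* At a first zero of a nonnegative shot both [u] and [u'] vanish, and the
   energy [u^2 + u'^2], weighted by an exponential, increases up to it. *)
Lemma nonneg_shot_positive (a : R) (u : R -> R) :
  0 < a -> shot a u -> (forall r, 0 <= u r) -> forall r, 0 < u r.
Proof.
intros Ha Hs Hnn r. apply Rnot_le_lt. intros Hn.
assert (Hu : continuity u) by apply Hs.
assert (HF := continuity_clamped_force u Hu).
assert (Hr : 0 < r).
{ apply Rnot_le_lt. intros L. rewrite (shot_0 a _ u Hs) in Hn by exact L. lra. }
destruct (first_hit u 0 r 0) as [z [Hz [Ez Hlz]]]; [lra| | |exact Hn|].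
{ intros x _. apply Hu. }
{ rewrite (shot_0 a _ u Hs) by lra. exact Ha. }
set (p := fun x => x * avg d (F u) x).
assert (Dz := is_derive_shot a z u Hs ltac:(lra)).
(* As [u] is nonnegative, its zero is a minimum, and it is interior because z > 0. *)
assert (Pz : p z = 0).
{ apply is_derive_Reals in Dz.
  assert (Q := deriv_minimum u (z - 1) (z + 1) z (exist _ (p z) Dz) ltac:(lra) ltac:(lra)).
  rewrite <- Q; [reflexivity|]. intros x _ _. rewrite Ez. apply Hnn. }
set (E := fun x => u x ^ 2 + p x ^ 2).
(* On [z/2, z] the three summands absorb, in order, the terms of E' coming from 2 u p, from the
   force (|F| <= (V(z) + 1) |u|), and from the friction 2 (d-1) p^2 / x with 1/x <= 2/z. *)
set (K := 1 + (V u z + 1) + 4 * Rabs (d - 1) / z).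
set (dE := fun x => 2 * u x * p x + 2 * p x * (F u x - (d - 1) / x * p x)).
assert (DE : forall x, 0 < x -> is_derive E x (dE x)).
{ intros x Hx. eapply is_derive_value.
  - apply (is_derive_plus (fun x => u x ^ 2) (fun x => p x ^ 2)).
    + apply (is_derive_pow u 2). apply (is_derive_shot a); auto. lra.
    + apply (is_derive_pow p 2). now apply is_derive_r_avg.
  - unfold dE, plus; simpl. fold (p x). ring. }
assert (HV0 : forall x, 0 <= x -> 0 <= V u x).
{ intros x Hx. rewrite <- (clamped_potential_0 u 0) by lra. apply clamped_potential_le; auto; lra. }
assert (Hmain : E (z / 2) * exp (K * (z / 2)) <= E z * exp (K * z)).
{ apply (nondecreasing_of_derive (fun x => E x * exp (K * x))
    (fun x => dE x * exp (K * x) + E x * (K * exp (K * x)))); [lra|..].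
  - intros x Hx. apply (is_derive_mult E (fun x => exp (K * x))).
    + apply DE. lra.
    + auto_derive; [exact I|ring].
    + intros s t. apply Rmult_comm.
  - intros x Hx. apply continuity_pt_mult; [|apply continuity_exp_lin].
    eapply is_derive_continuity_pt. apply DE. lra.
  - intros x Hx. replace (dE x * exp (K * x) + E x * (K * exp (K * x)))
      with ((dE x + K * E x) * exp (K * x)) by ring.
    apply Rmult_le_pos; [|apply Rlt_le, exp_pos].
    assert (V1 : 0 <= V u x <= V u z).
    { split; [apply HV0; lra|apply clamped_potential_le; auto; lra]. }
    assert (FB : Rabs (F u x) <= (V u z + 1) * Rabs (u x)).
    { unfold F, clamped_force. fold V. rewrite Rabs_mult. apply Rmult_le_compat;
        [apply Rabs_pos|apply Rabs_pos|apply Rabs_le; lra|].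
      apply clamp_abs_le. lra. }
    assert (GB : (d - 1) / x * p x ^ 2 <= 2 * Rabs (d - 1) / z * p x ^ 2).
    { apply Rmult_le_compat_r; [apply pow2_ge_0|].
      assert (Q := Rle_abs (d - 1)). assert (Q' := Rabs_pos (d - 1)).
      apply Rle_trans with (Rabs (d - 1) / x).
      - apply Rmult_le_compat_r; [apply Rlt_le, Rinv_0_lt_compat; lra|exact Q].
      - replace (2 * Rabs (d - 1) / z) with (Rabs (d - 1) * / (z / 2)) by (field; lra).
        apply Rmult_le_compat_l; [exact Q'|]. apply Rinv_le_contravar; lra. }
    assert (PF : - ((V u z + 1) * (u x ^ 2 + p x ^ 2)) <= 2 * p x * F u x).
    { assert (T : Rabs (p x * F u x) <= (V u z + 1) * (Rabs (p x) * Rabs (u x))).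
      { rewrite Rabs_mult. assert (Q := Rabs_pos (p x)). nra. }
      apply Rabs_le_between in T.
      assert (T2 : 2 * (Rabs (p x) * Rabs (u x)) <= u x ^ 2 + p x ^ 2).
      { rewrite <- (pow2_abs (u x)), <- (pow2_abs (p x)).
        assert (Q := pow2_ge_0 (Rabs (u x) - Rabs (p x))). nra. }
      nra. }
    assert (UP : - (u x ^ 2 + p x ^ 2) <= 2 * u x * p x).
    { assert (Q := pow2_ge_0 (u x + p x)). nra. }
    assert (UG : 0 <= 4 * Rabs (d - 1) / z * u x ^ 2).
    { apply Rmult_le_pos; [|apply pow2_ge_0].
      apply Rmult_le_pos; [|apply Rlt_le, Rinv_0_lt_compat; lra].
      assert (Q' := Rabs_pos (d - 1)). lra. }
    unfold dE, K, E.
    replace (2 * Rabs (d - 1) / z * p x ^ 2) with (4 * Rabs (d - 1) / z * p x ^ 2 / 2) in GB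
      by (field; lra).
    nra. }
assert (Ez0 : E z = 0) by (unfold E; rewrite Ez, Pz; ring).
rewrite Ez0, Rmult_0_l in Hmain.
assert (Q := Hlz (z / 2) ltac:(lra)). assert (Q' := exp_pos (K * (z / 2))).
assert (0 < E (z / 2)).
{ unfold E. assert (Q2 := pow2_ge_0 (p (z / 2))). nra. }
nra.
Qed.

(** Weak signs become strict. Suppose the slope vanishes at [r]. If V(r) <= 1, the force was
    negative on ]0, r[ and the slope must be negative; if V(r) > 1, the force is positive afterwards
    and the slope would be positive at r + 1. Monotonicity also keeps [u] at most [M], so the
    truncation is inactive on the half-line. *)
Lemma critical_shot_profile (a : R) (u : R -> R) :
  0 < a <= M -> shot a u -> (forall r, 0 <= u r) ->
  (forall r, 0 < r -> avg d (F u) r <= 0) -> profile d a u (V u).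
Proof.
intros Ha Hs Hnn Hn.
assert (Hpos := nonneg_shot_positive a u (proj1 Ha) Hs Hnn).
assert (Hu : continuity u) by apply Hs.
assert (HF := continuity_clamped_force u Hu).
assert (HV := continuity_clamped_potential d M u hd Hu). fold V in HV.
assert (Hc : forall s, 0 <= s -> clamp M (u s) = u s).
{ intros s Hs'. apply clamp_id. split; [apply Hnn|].
  apply Rle_trans with (u 0); [|rewrite (shot_0 a _ u Hs) by lra; lra].
  apply (shot_nonincreasing_on a); auto; [lra|]. intros x Hx. apply Hn. lra. }
assert (EF : forall s, 0 <= s -> F u s = (V u s - 1) * u s).
{ intros s Hs'. unfold F, clamped_force. fold V. now rewrite Hc. }
assert (Hg := continuity_minus_one_mul (V u) u HV Hu).
assert (Hsq := continuity_clamp_sqr u Hu).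
assert (Vlt : forall r s, 0 <= r < s -> V u r < V u s).
{ intros r s Hrs. apply (increasing_of_derive _
    (fun x => x * avg d (fun s => clamp M (u s) ^ 2) x)); [lra|..].
  - intros x Hx. apply is_derive_clamped_potential; auto. lra.
  - intros x _. apply HV.
  - intros x Hx. apply Rmult_lt_0_compat; [lra|]. apply avg_pos; auto; [lra|].
    intros y Hy. rewrite Hc by lra. assert (Q := Hpos y). nra. }
split; [exact Hu|split; [exact HV|split; [apply Ha|split; [|split; [|split]]]]].
- intros r. rewrite (proj2 Hs). f_equal. now apply rsol_ext.
- intros r. unfold V, clamped_potential. apply rsol_ext; auto using continuity_sqr. intros s Hs'. now rewrite Hc.
- intros r _. apply Hpos.
- intros r Hr.
  rewrite <- (avg_ext d (F u)) by (auto; intros s Hs'; apply EF; apply Hs').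
  destruct (Rle_lt_or_eq_dec _ _ (Hn r Hr)) as [L|E0]; [exact L|exfalso].
  destruct (Rle_dec (V u r) 1) as [HV1|HV1].
  + assert (avg d (F u) r < 0); [|lra]. apply avg_neg; auto.
    intros s Hs'. rewrite EF by lra. assert (Q := Vlt s r ltac:(lra)).
    assert (Q' := Hpos s). nra.
  + assert (0 < avg d (F u) (r + 1)); [|assert (Q := Hn (r + 1) ltac:(lra)); lra].
    apply (avg_pos_of_nonneg d (F u) r); auto; [lra| |lra].
    intros x Hx. rewrite EF by lra. assert (Q := Vlt r x ltac:(lra)).
    assert (Q' := Hpos x). nra.
Qed.

End Shooting.

Lemma is_derive_nonincreasing_nonpos (u : R -> R) (r l : R) :
  is_derive u r l -> (forall s, r <= s -> u s <= u r) -> l <= 0.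
Proof.
intros D H. apply Rnot_lt_le. intros Hl.
apply is_derive_Reals in D. destruct (D (l / 2)) as [del Hdel]; [lra|].
assert (Q := cond_pos del).
specialize (Hdel (del / 2) ltac:(lra) ltac:(rewrite Rabs_right; lra)).
specialize (H (r + del / 2) ltac:(lra)).
apply Rabs_def2 in Hdel.
assert ((u (r + del / 2) - u r) / (del / 2) <= 0); [|lra].
assert (0 < / (del / 2)) by (apply Rinv_0_lt_compat; lra). unfold Rdiv at 1. nra.
Qed.

Lemma profile_exists (d : R) : 0 < d -> exists u0 u V, profile d u0 u V.
Proof.
intros hd. set (M := 8 * (d + 2) / d).
assert (hM : 0 < M) by (apply Rdiv_lt_0_compat; lra).
set (N := clamped_force d M).
assert (HN : causal_lipschitz N) by (apply causal_lipschitz_clamped_force; lra).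
set (S := fun a => 0 < a <= M /\
  exists u, radial_fixpoint d N a u /\ exists r, 0 < r /\ u r < 0).
destruct (completeness S) as [a [Hub Hlub]].
{ exists M. intros a [Ha _]. lra. }
{ assert (P : 0 < d / (d + 6) ^ 2) by (apply Rdiv_lt_0_compat; nra).
  (* Since d <= (d+6)^2, this value is at most 1, so a (d+6)^2 <= d already implies the condition on
     a^2 in [small_shot_negative]. *)
  set (a := Rmin M (d / (d + 6) ^ 2)).
  assert (Ha : 0 < a <= M) by (split; [now apply Rmin_pos|apply Rmin_l]).
  destruct (radial_fixpoint_exists d N a hd HN) as [u Hu].
  exists a. split; [exact Ha|]. exists u. split; [exact Hu|].
  apply (small_shot_negative d M hd hM a); auto.
  assert (Ha2 : a * (d + 6) ^ 2 <= d).
  { assert (Q := Rmin_r M (d / (d + 6) ^ 2)). fold a in Q.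
    apply Rmult_le_compat_r with (r := (d + 6) ^ 2) in Q; [|nra].
    replace (d / (d + 6) ^ 2 * (d + 6) ^ 2) with d in Q by (field; lra). exact Q. }
  assert (a <= 1) by nra. nra. }
assert (HaM : a <= M) by (apply Hlub; intros x [Hx _]; lra).
assert (Hclose : forall eps, 0 < eps -> exists x, S x /\ a - eps < x <= a).
{ intros eps He. apply NNPP. intros Hn.
  assert (a <= a - eps); [|lra]. apply Hlub. intros x Hx.
  apply Rnot_lt_le. intros L. apply Hn. exists x. split; [exact Hx|].
  split; [exact L|now apply Hub]. }
assert (Ha : 0 < a).
{ destruct (Hclose 1 ltac:(lra)) as [x [[Hx _] Hx']]. lra. }
destruct (radial_fixpoint_exists d N a hd HN) as [u Hu].
exists a, u, (clamped_potential d M u).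
apply (critical_shot_profile d M hd hM); auto.
- intros r. apply Rnot_lt_le. intros Hr.
  assert (Hr0 : 0 < r).
  { apply Rnot_le_lt. intros L. rewrite (proj2 Hu), rsol_0 in Hr; lra. }
  (* The shot from [M] stays above M/2; a negative value therefore forces a < M and leaves room for
     an initial value above [a]. *)
  assert (a <> M).
  { intros E. assert (Hu' := Hu). rewrite E in Hu'.
    assert (Q := top_shot_positive d M hd hM u eq_refl Hu' r ltac:(lra)). lra. }
  destruct (radial_fixpoint_dependence d N r hd HN Hr0) as [C [HC Hdep]].
  (* Raising the initial value by [eta] moves the solution at [r] by at most -u(r)/2, so it is still
     negative there and [a + eta] belongs to [S], above its supremum. *)
  set (eta := Rmin (M - a) (- u r / (2 * C))).
  assert (Heta : 0 < eta).
  { apply Rmin_pos; [lra|]. apply Rdiv_lt_0_compat; lra. }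
  assert (Heta2 : C * eta <= - u r / 2).
  { assert (Q := Rmin_r (M - a) (- u r / (2 * C))). fold eta in Q.
    apply Rmult_le_compat_l with (r := C) in Q; [|lra].
    replace (C * (- u r / (2 * C))) with (- u r / 2) in Q by (field; lra). exact Q. }
  destruct (radial_fixpoint_exists d N (a + eta) hd HN) as [w Hw].
  assert (S (a + eta)); [|assert (Q := Hub _ H0); lra].
  split; [assert (Q := Rmin_l (M - a) (- u r / (2 * C))); fold eta in Q; lra|].
  exists w. split; [exact Hw|]. exists r. split; [exact Hr0|].
  assert (Q := Hdep _ _ w u Hw Hu r ltac:(lra)).
  replace (a + eta - a) with eta in Q by ring. rewrite (Rabs_right eta) in Q by lra.
  apply Rabs_le_between in Q. lra.
- intros r Hr.
  assert (Hle : forall s, r <= s -> u s <= u r).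
  { intros s Hs. apply Rnot_lt_le. intros L.
    destruct (radial_fixpoint_dependence d N s hd HN) as [C [HC Hdep]]; [lra|].
    (* Some shot [w] from [S] differs from [u] by less than a quarter of the supposed increase at
       both [r] and [s]; but shots from [S] are nonincreasing. *)
    destruct (Hclose ((u s - u r) / (4 * C))) as [x [[Hx [w [Hw [r2 [Hr2 Hw2]]]]] Hx2]].
    { apply Rdiv_lt_0_compat; lra. }
    assert (Hws : w s <= w r).
    { apply (shot_nonincreasing_on d M hd hM x); auto; [lra|]. intros y Hy.
      apply (negative_shot_nonincreasing d M hd hM x r2 w); auto; lra. }
    assert (Q1 := Hdep _ _ u w Hu Hw s ltac:(lra)).
    assert (Q2 := Hdep _ _ u w Hu Hw r ltac:(lra)).
    rewrite (Rabs_right (a - x)) in Q1, Q2 by lra.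
    assert (Q3 : C * (a - x) < C * ((u s - u r) / (4 * C))) by (apply Rmult_lt_compat_l; lra).
    replace (C * ((u s - u r) / (4 * C))) with ((u s - u r) / 4) in Q3 by (field; lra).
    apply Rabs_le_between in Q1. apply Rabs_le_between in Q2. lra. }
  assert (D := is_derive_shot d M hd hM a r u Hu ltac:(lra)).
  assert (Q := is_derive_nonincreasing_nonpos u r _ D Hle).
  apply Rnot_lt_le. intros L.
  assert (0 < r * avg d (clamped_force d M u) r) by (apply Rmult_lt_0_compat; lra). lra.
Qed.

(** * From integral equations to classical solutions and back *)

(* If [u] stayed above [eps], then [V] would exceed [2] and [u'] become positive. *)
Lemma profile_lim (d u0 : R) (u V : R -> R) :
  0 < d -> profile d u0 u V -> is_lim u p_infty 0.
Proof.
intros hd P. assert (P' := P). destruct P' as (Hu & HV & Hu0 & Eu & EV & Hp & Hn).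
assert (Hf := continuity_minus_one_mul V u HV Hu).
assert (Hsmall : forall eps, 0 < eps -> exists r, 0 < r /\ u r < eps).
{ intros eps He. apply NNPP. intros Hno.
  assert (Hge : forall r, 0 < r -> eps <= u r).
  { intros r Hr. apply Rnot_lt_le. intros L. apply Hno. now exists r. }
  assert (Hge0 : forall r, eps <= u r).
  { intros r. destruct (Rlt_dec 0 r) as [Hr|Hr]; [now apply Hge|].
    apply Rle_trans with (1 := Hge 1 ltac:(lra)). apply (profile_le d u0 u V); auto. lra. }
  (* From u >= eps one gets V(r) >= eps^2 r^2 / (2 d), which is at least 2 once r^2 >= 4 d / eps^2;
     the summand 1 makes r >= r0 imply this without a square root. *)
  set (r0 := 1 + 4 * d / eps ^ 2).
  assert (H4 : 0 < 4 * d / eps ^ 2) by (apply Rdiv_lt_0_compat; nra).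
  assert (HV2 : forall r, r0 <= r -> 2 <= V r).
  { intros r Hr. rewrite EV. unfold r0 in Hr.
    apply Rle_trans with (rsol d (fun _ => eps ^ 2) r).
    - rewrite rsol_const by lra. apply (Rmult_le_reg_r (2 * d)); [lra|].
      replace (eps ^ 2 * r ^ 2 / (2 * d) * (2 * d)) with (eps ^ 2 * r ^ 2) by (field; lra).
      assert (E : eps ^ 2 * (4 * d / eps ^ 2) = 4 * d) by (field; lra).
      assert (4 * d / eps ^ 2 <= r ^ 2) by nra.
      assert (0 < eps ^ 2) by nra. nra.
    - apply rsol_le; [exact hd|apply continuity_cst|now apply continuity_sqr|lra|].
      intros s Hs. apply pow_incr. specialize (Hge0 s). lra. }
  set (f := fun s => (V s - 1) * u s) in *.
  (* Beyond [r0] the force is at least [eps], so [wint] gains at least eps (r^d - r0^d); this radius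
     lets the gain outweigh whatever negative value was accumulated at [r0]. *)
  destruct (rpow_large d (rpow d r0 + Rabs (wint d f r0) / eps) hd) as [r1 [Hr1 HT]].
  assert (Hm : r1 <= Rmax r0 r1) by apply Rmax_r.
  assert (Hm' : r0 <= Rmax r0 r1) by apply Rmax_l.
  set (r := Rmax r0 r1) in *. specialize (HT r Hm).
  assert (W := wint_incr_le d (fun _ => eps) f r0 r hd (continuity_cst eps) Hf
    ltac:(unfold r0; lra) Hm').
  rewrite !wint_const in W.
  assert (W' : eps * rpow d r - eps * rpow d r0 <= wint d f r - wint d f r0).
  { apply W. intros s Hs. unfold f. assert (Q := HV2 s ltac:(lra)).
    assert (Q' := Hge0 s). nra. }
  assert (HT' : eps * (rpow d r0 + Rabs (wint d f r0) / eps) < eps * rpow d r)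
    by (apply Rmult_lt_compat_l; lra).
  replace (eps * (rpow d r0 + Rabs (wint d f r0) / eps))
    with (eps * rpow d r0 + Rabs (wint d f r0)) in HT' by (field; lra).
  assert (T := Rle_abs (- wint d f r0)). rewrite Rabs_Ropp in T.
  assert (Hr : 0 < r) by (unfold r0 in Hm'; lra).
  assert (Hw : 0 < wint d f r) by lra.
  rewrite avg_wint in Hw by lra. specialize (Hn r Hr). fold f in Hn.
  assert (Q := rpow_pos d r Hr). assert (0 < d * rpow d r) by nra. nra. }
apply is_lim_spec. intros eps. destruct (Hsmall eps (cond_pos eps)) as [r [Hr Hur]].
exists r. intros x Hx. assert (Q := Hp x ltac:(lra)).
assert (Q' := profile_le d u0 u V r x hd P ltac:(lra)).
rewrite Rminus_0_r, Rabs_right; lra.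
Qed.

Lemma D_in_of_is_derive (f f1 : R -> R) (D : R -> Prop) (r : R) :
  is_derive f r (f1 r) -> D_in f f1 D r.
Proof.
intros H eps He. apply is_derive_Reals in H. destruct (H eps He) as [del Hdel].
exists del. split; [apply cond_pos|]. intros x [[_ Hx] Hd]. change R in x.
simpl in Hd. unfold Rdist in Hd. simpl. unfold Rdist.
assert (Q := Hdel (x - r) ltac:(lra) Hd).
replace (r + (x - r)) with x in Q by ring. exact Q.
Qed.

Lemma is_derive_of_D_in (f f1 : R -> R) (r : R) :
  0 < r -> D_in f f1 half_line r -> is_derive f r (f1 r).
Proof.
intros Hr H. apply is_derive_Reals. intros eps He. destruct (H eps He) as [del [Hdel Hx]].
exists (mkposreal _ (Rmin_pos _ _ Hdel Hr)). intros h Hh Hd. simpl in Hd.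
assert (Q1 := Rmin_l del r). assert (Q2 := Rmin_r del r).
apply Rabs_def2 in Hd.
assert (X : D_x half_line r (r + h) /\ Rdist (r + h) r < del).
{ split; [split; [unfold half_line; lra|lra]|].
  unfold Rdist. apply Rabs_def1; lra. }
specialize (Hx (r + h) X). simpl in Hx. unfold Rdist in Hx.
replace (r + h - r) with h in Hx by ring. exact Hx.
Qed.

Lemma continue_in_of_continuity (f : R -> R) (D : R -> Prop) (r : R) :
  continuity_pt f r -> continue_in f D r.
Proof.
intros H eps He. destruct (H eps He) as [del [Hdel Hx]]. exists del.
split; [exact Hdel|]. intros x [[_ Hn] Hd]. apply Hx. split; [|exact Hd].
split; [exact I|exact Hn].
Qed.

(** Composing with [Rmax 0] continues [f] to the left by [f 0]; this turns one-sided regularity into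
    the two-sided kind used by the operators. *)
Lemma continuity_of_continue_in (f : R -> R) :
  (forall r, 0 <= r -> continue_in f half_line r) ->
  continuity (fun r => f (Rmax 0 r)).
Proof.
intros H r. apply continuity_pt_intro. intros eps He.
destruct (H (Rmax 0 r) (Rmax_l 0 r) eps He) as [del [Hdel Hx]].
destruct (continuity_pt_near (Rmax 0) r del (continuity_Rmax0 r) Hdel) as [del' [Hdel' Hm]].
exists del'. split; [exact Hdel'|]. intros y Hy.
destruct (Req_dec (Rmax 0 y) (Rmax 0 r)) as [E|n].
- rewrite E, Rminus_diag, Rabs_R0. exact He.
- apply (Hx (Rmax 0 y)). split; [split; [apply Rmax_l|congruence]|].
  now apply Hm.
Qed.

Lemma is_derive_0_id_mul (g : R -> R) :
  continuity_pt g 0 -> is_derive (fun x => x * g x) 0 (g 0).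
Proof.
intros Hg. apply is_derive_Reals. intros eps He.
destruct (continuity_pt_near g 0 eps Hg He) as [del [Hdel H]].
exists (mkposreal del Hdel). intros h Hh Hd. rewrite Rplus_0_l.
replace ((h * g h - 0 * g 0) / h - g 0) with (g h - g 0) by (field; exact Hh).
apply H. now rewrite Rminus_0_r.
Qed.

(** With u'/r = A continuous up to 0, the formula u'' = f - (d-1) A is continuous too. At the origin
    the difference quotient of r A(r) is A itself, whose limit f(0)/d agrees with the formula. *)
Lemma C2_half_line_rsol (d a : R) (f u : R -> R) :
  0 < d -> continuity f -> (forall r, u r = a + rsol d f r) ->
  C2_half_line u (fun r => r * avg d f r) (fun r => f r - (d - 1) * avg d f r).
Proof.
intros hd Hf E r Hr. assert (Ha := continuity_avg d f hd Hf). split; [|split].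
- apply D_in_of_is_derive. now apply (is_derive_affine_rsol d a).
- apply D_in_of_is_derive. destruct Hr as [Hr| <-].
  + eapply is_derive_value; [now apply is_derive_r_avg|]. field. lra.
  + eapply is_derive_value; [now apply is_derive_0_id_mul|].
    rewrite avg_0 by lra. field. lra.
- apply continue_in_of_continuity.
  apply continuity_pt_minus; [apply Hf|].
  apply continuity_pt_mult; [apply continuity_cst|apply Ha].
Qed.

Lemma radial_equation (d : R) (f : R -> R) (r : R) :
  0 < r -> f r - (d - 1) * avg d f r + (d - 1) / r * (r * avg d f r) = f r.
Proof. intros Hr. field. lra. Qed.

Lemma profile_decreasing_positive_solution (d u0 : R) (u V : R -> R) :
  0 < d -> profile d u0 u V -> decreasing_positive_solution d u0 u V.
Proof.
intros hd P. assert (Hlim := profile_lim d u0 u V hd P).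
destruct P as (Hu & HV & Hu0 & Eu & EV & Hp & Hn).
assert (Hf := continuity_minus_one_mul V u HV Hu). assert (Hsq := continuity_sqr u Hu).
split; [exact Hu0|].
set (f := fun s => (V s - 1) * u s) in *. set (g := fun s => u s ^ 2) in *.
exists (fun r => r * avg d f r), (fun r => f r - (d - 1) * avg d f r).
exists (fun r => r * avg d g r), (fun r => g r - (d - 1) * avg d g r).
split; [|split; [|exact Hlim]].
- split; [now apply (C2_half_line_rsol d u0)|].
  split; [apply (C2_half_line_rsol d 0); auto; intros r; rewrite EV; ring|].
  split; [intros r Hr; exact (radial_equation d f r Hr)|].
  split; [intros r Hr; exact (radial_equation d g r Hr)|].
  rewrite Eu, EV, !rsol_0 by lra. repeat split; ring.
- intros r Hr. split; [now apply Hp|]. specialize (Hn r Hr). nra.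
Qed.

(** Differentiability of [w1] at 0 together with [w1 0 = 0] bounds w'/r near the origin. This
    excludes the homogeneous solution r^(-d) of the equation for w'/r, so [avg_unique] applies. *)
Lemma radial_solution_rsol (d : R) (f w w1 w2 : R -> R) :
  0 < d -> continuity f -> C2_half_line w w1 w2 -> w1 0 = 0 ->
  (forall r, 0 < r -> w2 r + (d - 1) / r * w1 r = f r) ->
  continuity (fun r => w (Rmax 0 r)) /\
  (forall r, 0 < r -> w1 r = r * avg d f r) /\
  (forall r, w (Rmax 0 r) = w 0 + rsol d f r).
Proof.
intros hd Hf HC H1 Heq.
assert (Hc : continuity (fun r => w (Rmax 0 r))).
{ apply continuity_of_continue_in. intros r Hr. apply cont_deriv with w1. now apply HC. }
assert (Dw1 : forall r, 0 < r -> is_derive w1 r (w2 r)).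
{ intros r Hr. apply is_derive_of_D_in; [exact Hr|]. apply HC. lra. }
destruct (HC 0 (Rle_refl 0)) as [_ [D0 _]]. destruct (D0 1 Rlt_0_1) as [del [Hdel Hx]].
assert (HB : forall r, 0 < r -> w1 r / r = avg d f r).
{ apply (avg_unique d f (fun r => w1 r / r) del (Rabs (w2 0) + 1)); auto.
  - intros r Hr. assert (X : D_x half_line 0 r /\ Rdist r 0 < del).
    { split; [split; [unfold half_line; lra|lra]|].
      unfold Rdist. rewrite Rminus_0_r, Rabs_right; lra. }
    specialize (Hx r X). simpl in Hx. unfold Rdist in Hx.
    rewrite H1, !Rminus_0_r in Hx.
    assert (T := Rabs_triang_inv (w1 r / r) (w2 0)). lra.
  - intros r Hr. eapply is_derive_value.
    + apply (is_derive_div w1 (fun r => r)); [now apply Dw1|apply is_derive_id|lra].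
    + rewrite <- Heq by exact Hr. unfold one; simpl. field. lra. }
assert (Hw1 : forall r, 0 < r -> w1 r = r * avg d f r).
{ intros r Hr. rewrite <- HB by exact Hr. field. lra. }
split; [exact Hc|split; [exact Hw1|]].
intros r. destruct (Rle_dec r 0) as [Hr|Hr].
{ rewrite Rmax_left, rsol_0 by exact Hr. ring. }
assert (E := rsol_eq_of_derive d f (fun r => w (Rmax 0 r)) hd Hf Hc).
simpl in E. rewrite (Rmax_left 0 0) in E by lra. apply E; [|lra].
intros x Hx'. rewrite <- Hw1 by exact Hx'.
apply (is_derive_ext_loc w).
- exists (mkposreal x Hx'). intros y Hy. apply Rabs_def2 in Hy. simpl in Hy.
  unfold minus, plus, opp in Hy; simpl in Hy. rewrite Rmax_right; lra.
- apply is_derive_of_D_in; [exact Hx'|]. apply HC. lra.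
Qed.

Lemma decreasing_positive_solution_profile (d w0 : R) (w W : R -> R) :
  0 < d -> decreasing_positive_solution d w0 w W ->
  profile d w0 (fun r => w (Rmax 0 r)) (fun r => W (Rmax 0 r)).
Proof.
intros hd [Hw0 [w1 [w2 [W1 [W2 [S [Hdec _]]]]]]].
destruct S as (Cw & CW & Ew & EW & I1 & I2 & I3 & I4).
set (u := fun r => w (Rmax 0 r)). set (V := fun r => W (Rmax 0 r)).
assert (Hu : continuity u).
{ apply continuity_of_continue_in. intros r Hr. apply cont_deriv with w1. now apply Cw. }
assert (HV : continuity V).
{ apply continuity_of_continue_in. intros r Hr. apply cont_deriv with W1. now apply CW. }
assert (Hpos : forall r, 0 <= r -> u r = w r /\ V r = W r).
{ intros r Hr. unfold u, V. rewrite Rmax_right by exact Hr. now split. }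
destruct (radial_solution_rsol d (fun s => (V s - 1) * u s) w w1 w2) as [_ [A1 A2]]; auto.
{ now apply continuity_minus_one_mul. }
{ intros r Hr. destruct (Hpos r ltac:(lra)) as [-> ->]. now apply Ew. }
destruct (radial_solution_rsol d (fun s => u s ^ 2) W W1 W2) as [_ [_ B2]]; auto.
{ now apply continuity_sqr. }
{ intros r Hr. destruct (Hpos r ltac:(lra)) as [-> _]. now apply EW. }
split; [exact Hu|split; [exact HV|split; [exact Hw0|split; [|split; [|split]]]]].
- intros r. rewrite <- I1. apply A2.
- intros r. unfold V. rewrite B2, I3. ring.
- intros r Hr. destruct (Hpos r ltac:(lra)) as [-> _]. now apply Hdec.
- intros r Hr. destruct (Hdec r Hr) as [_ Q]. rewrite (A1 r Hr) in Q.
  apply Rnot_le_lt. intros L. nra.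
Qed.

(** * The Lane-Emden equation *)

Definition clamped_lane_emden (u : R -> R) (s : R) : R := - clamp 1 (u s) ^ 2.

Lemma causal_lipschitz_clamped_lane_emden : causal_lipschitz clamped_lane_emden.
Proof.
split.
- intros u Hu. apply continuity_opp. apply (continuity_sqr (fun s => clamp 1 (u s))).
  now apply continuity_clamp_comp.
- intros b Hb. exists 2. split; [lra|]. intros u w L T _ _ _ _ H s Hs.
  specialize (H s Hs). unfold clamped_lane_emden.
  assert (Q1 := clamp_sqr_le 1 (u s) (w s) ltac:(lra)).
  assert (Q2 := clamp_sqr_le 1 (w s) (u s) ltac:(lra)).
  rewrite (Rabs_minus_sym (w s)) in Q2. apply Rabs_le. lra.
Qed.

Lemma rsol_opp (d : R) (f : R -> R) (r : R) :
  0 < d -> continuity f -> rsol d (fun s => - f s) r = - rsol d f r.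
Proof.
intros hd Hf. assert (Hf' : continuity (fun s => - f s)) by now apply continuity_opp.
assert (A : forall x, avg d (fun s => - f s) x = - avg d f x).
{ intros x. unfold avg. destruct (Rle_dec x 0) as [n|n]; [field; lra|].
  assert (E : wint d (fun s => - f s) x = - wint d f x).
  { unfold wint. apply (RInt_opp (fun y => f (rpow (/ d) y))).
    apply (ex_RInt_continuous (fun y => f (rpow (/ d) y))). intros z _.
    apply continuity_pt_filterlim, continuity_comp_rpow; [|exact Hf].
    now apply Rinv_0_lt_compat. }
  rewrite E. unfold Rdiv. ring. }
destruct (Rle_dec r 0) as [Hr|Hr]; [rewrite !rsol_0 by exact Hr; ring|].
assert (E := rsol_eq_of_derive d (fun s => - f s) (fun x => - rsol d f x) hd Hf').
rewrite E, (rsol_0 d f 0); try lra.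
- apply continuity_opp. now apply continuity_rsol.
- intros x Hx. rewrite A. eapply is_derive_value.
  + apply (is_derive_opp (rsol d f)). apply is_derive_rsol_pos; auto. lra.
  + unfold opp; simpl. ring.
Qed.

(* Pohozaev: with [A = u'/r], the quantity [r^d P] below vanishes at [0] and has
   derivative [r^(d-1) u^3 (6 - d) / 6 <= 0] as long as [u > 0], whereas at a
   first zero of [u] it equals [r^d u'^2 / 2 > 0]. *)
Lemma lane_emden_positive (d : R) (u : R -> R) :
  6 <= d -> radial_fixpoint d clamped_lane_emden 1 u ->
  (forall r, 0 < r -> avg d (clamped_lane_emden u) r < 0) /\
  (forall r, 0 < u r <= 1).
Proof.
intros hd6 [Hu E]. assert (hd : 0 < d) by lra.
set (f := clamped_lane_emden u) in *.
assert (Hf : continuity f) by now apply causal_lipschitz_clamped_lane_emden.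
assert (U0 : forall r, r <= 0 -> u r = 1) by (intros r Hr; rewrite E, rsol_0; lra).
assert (Du : forall r, 0 <= r -> is_derive u r (r * avg d f r)).
{ intros r Hr. now apply (is_derive_affine_rsol d 1). }
assert (Hn : forall r, 0 < r -> avg d f r < 0).
{ intros r Hr. apply avg_neg_of_nonpos; auto.
  - unfold f, clamped_lane_emden. rewrite (U0 0), clamp_id by lra. lra.
  - intros s _. unfold f, clamped_lane_emden. assert (Q := pow2_ge_0 (clamp 1 (u s))). lra. }
assert (Hle : forall r, u r <= 1).
{ intros r. destruct (Rle_dec r 0) as [Hr|Hr]; [rewrite U0; lra|].
  rewrite <- (U0 0) by lra.
  apply (nonincreasing_of_derive u (fun r => r * avg d f r)); [lra|..].
  - intros x Hx. apply Du. lra.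
  - intros x _. apply Hu.
  - intros x Hx. specialize (Hn x ltac:(lra)). nra. }
split; [exact Hn|]. intros r. split; [|apply Hle].
apply Rnot_le_lt. intros Hneg.
destruct (first_hit u 0 r 0) as [z [Hz [Ez Hlz]]]; [| | |exact Hneg|].
{ apply Rnot_lt_le. intros L. rewrite U0 in Hneg; lra. }
{ intros x _. apply Hu. }
{ rewrite U0; lra. }
assert (Ef : forall x, 0 < x < z -> f x = - u x ^ 2).
{ intros x Hx. unfold f, clamped_lane_emden. rewrite clamp_id; [reflexivity|].
  split; [apply Rlt_le, Hlz; lra|apply Hle]. }
set (A := avg d f) in *. assert (HA : continuity A) by now apply continuity_avg.
(* The coefficient (d-2)/2 cancels the u'^2 terms in the derivative of r^d P. What remains of the
   u^3 terms is d/3 - (d-2)/2 = (6-d)/6, whence the threshold d = 6. *)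
set (P := fun x => / 2 * (x * A x) ^ 2 + / 3 * u x ^ 3 + (d - 2) / 2 * (u x * A x)).
set (dP := fun x => x * A x * (f x - (d - 1) / x * (x * A x)) + u x ^ 2 * (x * A x)
  + (d - 2) / 2 * (x * A x * A x + u x * ((f x - d * A x) / x))).
assert (HP : continuity P).
{ unfold P. apply continuity_plus; [apply continuity_plus|].
  - apply continuity_mult; [apply continuity_cst|].
    apply (continuity_sqr (fun x => x * A x)). apply continuity_mult; [|exact HA].
    apply derivable_continuous, derivable_id.
  - apply continuity_mult; [apply continuity_cst|].
    apply (continuity_comp u (fun y => y ^ 3)); [exact Hu|].
    apply derivable_continuous, derivable_pow.
  - apply continuity_mult; [apply continuity_cst|now apply continuity_mult]. }
assert (DP : forall x, 0 < x -> is_derive P x (dP x)).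
{ intros x Hx.
  assert (D1 : is_derive (fun x => x * A x) x (f x - (d - 1) / x * (x * A x)))
    by now apply is_derive_r_avg.
  assert (D2 := Du x ltac:(lra)).
  assert (D3 : is_derive A x ((f x - d * A x) / x)) by now apply is_derive_avg.
  eapply is_derive_value.
  - apply (is_derive_plus (fun x => / 2 * (x * A x) ^ 2 + / 3 * u x ^ 3)
      (fun x => (d - 2) / 2 * (u x * A x))).
    + apply (is_derive_plus (fun x => / 2 * (x * A x) ^ 2) (fun x => / 3 * u x ^ 3)).
      * apply (is_derive_scal (fun x => (x * A x) ^ 2)). exact (is_derive_pow _ 2 x _ D1).
      * apply (is_derive_scal (fun x => u x ^ 3)). exact (is_derive_pow u 3 x _ D2).
    + apply (is_derive_scal (fun x => u x * A x)).
      apply (is_derive_mult u A x _ _ D2 D3). intros; apply Rmult_comm.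
  - unfold dP, A, plus, mult; simpl. field. lra. }
assert (M : rpow d z * P z <= rpow d 0 * P 0).
{ apply (nonincreasing_of_derive (fun x => rpow d x * P x)
    (fun x => d * rpow d x / x * P x + rpow d x * dP x)); [lra|..].
  - intros x Hx. apply (is_derive_mult (rpow d) P).
    + apply is_derive_rpow. lra.
    + apply DP. lra.
    + intros; apply Rmult_comm.
  - intros x _. apply continuity_pt_mult; [now apply continuity_rpow|apply HP].
  - intros x Hx.
    replace (d * rpow d x / x * P x + rpow d x * dP x)
      with (- (rpow d x * / x * u x ^ 3 * ((d - 6) / 6)))
      by (unfold P, dP; rewrite (Ef x Hx); field; lra).
    assert (Q := Hlz x ltac:(lra)). assert (Q' := rpow_pos d x ltac:(lra)).
    assert (Q'' := Rinv_0_lt_compat x ltac:(lra)).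
    enough (0 <= rpow d x * / x * u x ^ 3 * ((d - 6) / 6)) by lra.
    apply Rmult_le_pos; [|lra]. apply Rmult_le_pos; [|apply pow_le; lra].
    apply Rmult_le_pos; lra. }
rewrite (rpow_0 d 0) in M by lra.
assert (Q := rpow_pos d z ltac:(lra)). assert (Q' := Hn z ltac:(lra)).
assert (0 < P z).
{ unfold P. rewrite Ez. assert (0 < (z * A z) ^ 2) by (apply pow2_gt_0; nra). lra. }
nra.
Qed.

(** For V = 1 - u the force (V - 1) u is -u^2, so the two integral equations become one. The fixed
    point property is returned as well, since for d = 6 it identifies [u] with the explicit
    function. *)
Lemma lane_emden_profile (d : R) :
  6 <= d -> exists u V, profile d 1 u V /\
    radial_fixpoint d clamped_lane_emden 1 u /\ forall r, V r = 1 - u r.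
Proof.
intros hd6. assert (hd : 0 < d) by lra.
destruct (radial_fixpoint_exists d clamped_lane_emden 1 hd
  causal_lipschitz_clamped_lane_emden) as [u Hfix].
exists u, (fun r => 1 - u r). split; [|split; [exact Hfix|reflexivity]].
destruct (lane_emden_positive d u hd6 Hfix) as [Hn Hb]. destruct Hfix as [Hu E].
assert (HV : continuity (fun r => 1 - u r))
  by (apply continuity_minus; [apply continuity_cst|exact Hu]).
assert (Hg := continuity_minus_one_mul (fun r => 1 - u r) u HV Hu).
assert (Hf : continuity (clamped_lane_emden u))
  by now apply causal_lipschitz_clamped_lane_emden.
assert (Ef : forall s, clamped_lane_emden u s = (1 - u s - 1) * u s).
{ intros s. unfold clamped_lane_emden. rewrite clamp_id by (specialize (Hb s); lra). ring. }
split; [exact Hu|split; [exact HV|split; [lra|split; [|split; [|split]]]]].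
- intros r. rewrite E. f_equal. apply rsol_ext; auto.
- intros r. rewrite E.
  rewrite (rsol_ext d (clamped_lane_emden u) (fun s => - u s ^ 2)); auto.
  + rewrite rsol_opp by (auto using continuity_sqr). ring.
  + apply continuity_opp. now apply continuity_sqr.
  + intros s _. rewrite Ef. ring.
- intros r _. apply Hb.
- intros r Hr. rewrite <- (avg_ext d (clamped_lane_emden u)); auto.
Qed.

Lemma lane_emden_6 :
  radial_fixpoint 6 clamped_lane_emden 1 (fun r => / (1 + Rmax 0 r ^ 2 / 24) ^ 2).
Proof.
set (w := fun r => / (1 + r ^ 2 / 24) ^ 2).
assert (Hpos : forall r, 1 <= 1 + r ^ 2 / 24) by (intros r; assert (Q := pow2_ge_0 r); lra).
assert (Dw : forall r, is_derive w r (r * (- / 6 * / (1 + r ^ 2 / 24) ^ 3))).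
{ intros r. assert (Q := Hpos r). unfold w. auto_derive; [nra|]. field. nra. }
assert (Hw : continuity w) by (intros r; eapply is_derive_continuity_pt, Dw).
assert (Hwm : continuity (fun r => w (Rmax 0 r))).
{ apply (continuity_comp (Rmax 0) w); [apply continuity_Rmax0|exact Hw]. }
assert (Hf := proj1 causal_lipschitz_clamped_lane_emden _ Hwm).
assert (hd : 0 < 6) by lra.
(* The left side is w'/r. It is bounded and satisfies r A' + 6 A = -w^2, hence is the average of the
   force; the truncation is inactive because 0 < w <= 1. *)
assert (HA : forall r, 0 < r -> - / 6 * / (1 + r ^ 2 / 24) ^ 3
  = avg 6 (clamped_lane_emden (fun r => w (Rmax 0 r))) r).
{ apply (avg_unique 6 _ (fun r => - / 6 * / (1 + r ^ 2 / 24) ^ 3) 1 1); auto; [lra|..].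
  - intros r _. assert (Q : 1 <= (1 + r ^ 2 / 24) ^ 3) by (apply pow_R1_Rle, Hpos).
    assert (0 < / (1 + r ^ 2 / 24) ^ 3 <= 1).
    { split; [apply Rinv_0_lt_compat; lra|]. rewrite <- Rinv_1. apply Rinv_le_contravar; lra. }
    apply Rabs_le. lra.
  - intros r Hr. assert (Q := Hpos r). eapply is_derive_value.
    + auto_derive; [|reflexivity]. nra.
    + unfold clamped_lane_emden. rewrite Rmax_right by lra. rewrite clamp_id.
      * unfold w. field. nra.
      * assert (Q' : 1 <= (1 + r ^ 2 / 24) ^ 2) by (apply pow_R1_Rle, Hpos).
        unfold w. split; [apply Rlt_le, Rinv_0_lt_compat; lra|].
        rewrite <- Rinv_1. apply Rinv_le_contravar; lra. }
split; [exact Hwm|]. intros r.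
change (w (Rmax 0 r) = 1 + rsol 6 (clamped_lane_emden (fun r => w (Rmax 0 r))) r).
replace 1 with (w 0) by (unfold w; field).
destruct (Rle_dec r 0) as [Hr|Hr].
- rewrite rsol_0, Rmax_left by exact Hr. ring.
- rewrite Rmax_right by lra. apply (rsol_eq_of_derive 6 _ w hd Hf Hw); [|lra].
  intros x Hx. change (fun r0 => / (1 + Rmax 0 r0 ^ 2 / 24) ^ 2) with (fun r => w (Rmax 0 r)).
  rewrite <- HA by exact Hx. apply Dw.
Qed.

Theorem theorem1p1 (d : R) (hd : 0 < d) :
  exists (u0 : R) (u V : R -> R),
    decreasing_positive_solution d u0 u V /\
    (forall (w0 : R) (w W : R -> R),
        decreasing_positive_solution d w0 w W ->
        w0 = u0 /\ forall r : R, 0 <= r -> w r = u r /\ W r = V r) /\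
    (d = 6 -> forall r : R, 0 <= r -> u r = / (1 + r ^ 2 / 24) ^ 2) /\
    (6 <= d ->
       (forall r : R, 0 <= r -> u r = 1 - V r) /\
       lane_emden_solution d u).
Proof.
destruct (profile_exists d hd) as [u0 [u [V P]]]. exists u0, u, V.
split; [now apply profile_decreasing_positive_solution|split; [|split]].
- intros w0 w W S. apply decreasing_positive_solution_profile in S; [|exact hd].
  destruct (profile_unique d u0 w0 u V _ _ hd P S) as [E H]. split; [exact E|].
  intros r Hr. specialize (H r). now rewrite Rmax_right in H.
- intros -> r Hr. destruct (lane_emden_profile 6) as [v [Z [Pv [Fv _]]]]; [lra|].
  destruct (profile_unique 6 1 u0 v Z u V hd Pv P) as [_ H].
  rewrite (proj1 (H r)).
  rewrite (radial_fixpoint_unique 6 clamped_lane_emden 1 v _ hd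
    causal_lipschitz_clamped_lane_emden Fv lane_emden_6).
  now rewrite Rmax_right.
- intros hd6. destruct (lane_emden_profile d hd6) as [v [Z [Pv [_ EZ]]]].
  destruct (profile_unique d 1 u0 v Z u V hd Pv P) as [E0 H].
  (* The critical solution coincides with the Lane-Emden one, so it inherits V = 1 - u, and its
     equation for [u] becomes the Lane-Emden equation. *)
  assert (EV : forall r, V r = 1 - u r).
  { intros r. destruct (H r) as [-> ->]. apply EZ. }
  split; [intros r _; rewrite EV; ring|].
  destruct P as (Hu & HV & _ & Eu & _ & _ & _).
  assert (Hf := continuity_minus_one_mul V u HV Hu).
  exists (fun r => r * avg d (fun s => (V s - 1) * u s) r).
  exists (fun r => (V r - 1) * u r - (d - 1) * avg d (fun s => (V s - 1) * u s) r).
  split; [now apply (C2_half_line_rsol d u0 (fun s => (V s - 1) * u s))|].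
  split; [|split; [rewrite Eu, rsol_0; lra|ring]].
  intros r Hr.
  rewrite (radial_equation d (fun s => (V s - 1) * u s)) by exact Hr.
  rewrite EV. ring.
Qed.
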